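(* Let $L=L(t;\mathsf x^i,\mathsf v^i,\mathsf v_{(1)}^i,\dots,\mathsf v_{(k-1)}^i)$ be a smooth Lagrange function of order $k$ on $J^k(\mathbb R,Q)$, let $\Lambda=L\,dt$, and let $\mathsf E_i$ be its variational (Euler–Lagrange) expressions, defined on $J^s(\mathbb R,Q)$ for some $s\le 2k$. Let $\mathcal L_0=\dot t\cdot(L\circ\wp^k)$ be the associated Lagrange function on $\{\dot t\neq 0\}\subset T^kM$, $M=\mathbb R\times Q$, where $\wp^r:T^rM\to J^r(\mathbb R,Q)$ is the projection described in the context. Then the variational (Euler–Lagrange) expressions $\mathcal E_\alpha$ (with respect to the coordinates $x^0=t$, $x^i=\mathsf x^i$ of $M$ and the parameter $\zeta$) corresponding to the Lagrange function $\mathcal L_0$ are $$\mathcal E_0=-u^i\,(\mathsf E_i\circ\wp^s),\qquad \mathcal E_i=\dot t\,(\mathsf E_i\circ\wp^s),$$ where summation over the repeated index $i$ is understood and $u^i=\dot x^i$.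
   Context: $M=\mathbb R\times Q$ has local coordinates $x^\alpha=(t,\mathsf x^i)$, $1\le i\le \dim Q$. The space $T^rM$ of Ehresmann velocities consists of derivatives up to order $r$ at $0\in\mathbb R$ of curves $\zeta\mapsto x^\alpha(\zeta)$ in $M$; it has coordinates $x^\alpha,\dot x^\alpha,\ddot x^\alpha,\dots,x^\alpha_{(r)}$, and one writes $u^\alpha=\dot x^\alpha$, so $u^0=\dot t$. $J^r(\mathbb R,Q)$ is the space of $r$-jets of curves $t\mapsto \mathsf x^i(t)$, with coordinates $t;\mathsf x^i,\mathsf v^i=d\mathsf x^i/dt,\mathsf v_{(1)}^i=d^2\mathsf x^i/dt^2,\dots,\mathsf v_{(r-1)}^i=d^r\mathsf x^i/dt^r$ (also $\mathsf v_{(0)}=\mathsf v$, $\mathsf v_{(1)}=\mathsf v'$, $\mathsf v_{(2)}=\mathsf v''$). The projection $\wp^r$, defined where $\dot t\ne0$, sends the $r$-th order velocity of a curve $\zeta\mapsto(t(\zeta),\mathsf x^i(\zeta))$ to the $r$-jet of the same curve re-expressed with $t$ as independent variable (so $t$-derivatives are obtained by iterating $\dot t^{-1}\,d/d\zeta$); e.g. $\dot t\,\mathsf v^i=u^i$, $\ \dot t^3\mathsf v'^i=\dot t\,\dot u^i-\ddot t\,u^i$, $\ \dot t^5\mathsf v''^i=\dot t^2\ddot u^i-3\dot t\,\ddot t\,\dot u^i+[3\ddot t^2-\dot t\,t_{(3)}]u^i$. The variational expressions are the usual higher-order Euler–Lagrange expressions: $$\mathsf E_i=\frac{\partial L}{\partial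 \mathsf x^i}+\sum_{r=1}^{k}(-1)^r D_t^r\frac{\partial L}{\partial \mathsf v_{(r-1)}^i},\qquad \mathcal E_\alpha=\frac{\partial\mathcal L_0}{\partial x^\alpha}+\sum_{r=1}^{k}(-1)^r D_\zeta^r\frac{\partial\mathcal L_0}{\partial x_{(r)}^\alpha},$$ where $D_t$ and $D_\zeta$ are the total derivatives with respect to $t$ and $\zeta$. *)

(* Defs.v *)
From mathcomp Require Import all_boot all_order all_algebra.
From mathcomp Require Import all_classical all_reals all_analysis.

Set Implicit Arguments.
Unset Strict Implicit.
Unset Printing Implicit Defensive.

Import GRing.Theory numFieldNormedType.Exports.

Local Open Scope classical_set_scope.
Local Open Scope ring_scope.

(* A point of J^r(R, Q), in coordinates on Q, is a pair (t, X) where X a i is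
   the a-th t-derivative of x^i, 0 <= a <= r.  So row 0 of X is x, and row a.+1
   is v_(a). *)
Notation jet R n r := (R * 'M[R]_(r.+1, n))%type.

(* A point of T^r(R x Q) is a matrix whose entry (a, alpha) is x^alpha_(a);
   column ord0 is t, column lift ord0 i is x^i. *)
Notation vel R n r := 'M[R]_(r.+1, n.+1).

Section Smooth.
Variables (R : realType) (V : normedModType R).

Fixpoint Ck (m : nat) (O : set V) (f : V -> R) : Prop :=
  match m with
  | 0 => forall x, O x -> {for x, continuous f}
  | m'.+1 => (forall x, O x -> differentiable f x) /\
             (forall v, Ck m' O ('D_v f))
  end.

Definition smooth (O : set V) (f : V -> R) : Prop := forall m, Ck m O f.

End Smooth.

Section Jets.
Variables (R : realType) (n : nat).

(* The rows of order at most r; only meaningful when r <= q. *)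
Definition trunc (q r m : nat) (X : 'M[R]_(q.+1, m)) : 'M[R]_(r.+1, m) :=
  \matrix_(a, i) X (inord a) i.

Definition jtrunc (q r : nat) (j : jet R n q) : jet R n r :=
  (j.1, trunc r j.2).

(* U is the image of a chart of Q; t and all the derivatives are unrestricted. *)
Definition jet_over (U : set 'rV[R]_n) (r : nat) : set (jet R n r) :=
  [set j | U (row ord0 j.2)].
#[global] Arguments jet_over U r _ : clear implicits.

Definition vel_over (U : set 'rV[R]_n) (r : nat) : set (vel R n r) :=
  [set w | U (\row_i w ord0 (lift ord0 i))].
#[global] Arguments vel_over U r _ : clear implicits.

Definition jpartial_t (r : nat) (F : jet R n r -> R) : jet R n r -> R :=
  'D_((1, 0) : jet R n r) F.

Definition jpartial (r : nat) (a : 'I_r.+1) (i : 'I_n) (F : jet R n r -> R) :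
    jet R n r -> R :=
  'D_((0, delta_mx a i) : jet R n r) F.

Definition vpartial (r : nat) (a : 'I_r.+1) (al : 'I_n.+1)
    (F : vel R n r -> R) : vel R n r -> R :=
  'D_(delta_mx a al : vel R n r) F.

Definition jtotal (r : nat) (F : jet R n r -> R) : jet R n r.+1 -> R :=
  fun j => jpartial_t F (jtrunc r j) +
    \sum_(a < r.+1) \sum_(i < n) j.2 (lift ord0 a) i * jpartial a i F (jtrunc r j).

Definition vtotal (r : nat) (F : vel R n r -> R) : vel R n r.+1 -> R :=
  fun w => \sum_(a < r.+1) \sum_(al < n.+1)
    w (lift ord0 a) al * vpartial a al F (trunc r w).

Fixpoint jtotaln (m r : nat) (F : jet R n r -> R) : jet R n (m + r) -> R :=
  match m return jet R n (m + r) -> R with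
  | 0 => F
  | m'.+1 => jtotal (@jtotaln m' r F)
  end.
#[global] Arguments jtotaln m {r} F _.

Fixpoint vtotaln (m r : nat) (F : vel R n r -> R) : vel R n (m + r) -> R :=
  match m return vel R n (m + r) -> R with
  | 0 => F
  | m'.+1 => vtotal (@vtotaln m' r F)
  end.
#[global] Arguments vtotaln m {r} F _.

(* The summand a = 0 is the derivative with respect to x^i itself; the a-th
   summand has order a + k <= 2 * k. *)
Definition jEL (k : nat) (L : jet R n k -> R) (i : 'I_n) :
    jet R n (2 * k) -> R :=
  fun j => \sum_(a < k.+1)
    (-1) ^+ a * jtotaln a (jpartial a i L) (jtrunc (a + k) j).

Definition vEL (k : nat) (F : vel R n k -> R) (al : 'I_n.+1) :
    vel R n (2 * k) -> R :=
  fun w => \sum_(a < k.+1)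
    (-1) ^+ a * vtotaln a (vpartial a al F) (trunc (a + k) w).

(* Only meaningful when 0 < r. *)
Definition uvel (r : nat) (w : vel R n r) (al : 'I_n.+1) : R := w (inord 1) al.

Definition tdot (r : nat) (w : vel R n r) : R := uvel w ord0.

(* The a-th t-derivative of x^i along a curve, as a function of the a-th order
   velocity of that curve: (tdot^-1 D_zeta)^a x^i, where D_zeta is vtotal. *)
Fixpoint tderiv (a : nat) (i : 'I_n) : vel R n a -> R :=
  match a return vel R n a -> R with
  | 0 => fun w => w ord0 (lift ord0 i)
  | a'.+1 => fun w => (tdot w)^-1 * vtotal (@tderiv a' i) w
  end.

(* The projection T^r M -> J^r; only meaningful where tdot != 0 (for r > 0). *)
Definition wp (r : nat) (w : vel R n r) : jet R n r :=
  (w ord0 ord0, \matrix_(a < r.+1, i < n) tderiv i (trunc a w)).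

Definition homLagrangian (k : nat) (L : jet R n k -> R) : vel R n k -> R :=
  fun w => tdot w * L (wp w).

End Jets.

(* Main.v *)
(* The function v_b = (tdot^-1 D)^b x^i is differentiated with respect to the
   order-a velocities of x^al; the coefficients, as a differential operator
   l_b = sum_a (d v_b / d x^al_(a)) D^a, satisfy
     l_(b+1) = tdot^-1 D o l_b - [al = 0] tdot^-1 v_(b+1) D,
   because [d/dx_(a), D] = d/dx_(a-1) by the symmetry of second derivatives.
   Euler-Lagrange expressions are formal adjoints evaluated at 1, and the adjoint
   of tdot^-1 D is psi |-> - D (tdot^-1 psi), which applied b times to tdot * g
   gives tdot * (- tdot^-1 D)^b g, that is tdot * (- D_t)^b g.  By induction on b,
     l_b^*(psi) = ([al = i] - [al = 0] v_1) (- D tdot^-1)^b psi + [al = 0] v_(b+1) psi.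
   For al = 0 the terms v_(b+1) psi assemble into the total derivative of L and
   cancel against the derivatives of L0 through t and tdot.
   To have a single derivation D = d/dzeta acting on functions of one variable,
   everything is evaluated along a polynomial curve through the given velocity. *)
Require Import Defs.
From mathcomp Require Import all_boot all_order all_algebra.
From mathcomp Require Import all_classical all_reals all_analysis.
From HB Require Import structures.
From mathcomp Require Import ring.

Set Implicit Arguments.
Unset Strict Implicit.
Unset Printing Implicit Defensive.

Import Order.TTheory GRing.Theory Num.Theory numFieldNormedType.Exports.

Local Open Scope classical_set_scope.
Local Open Scope ring_scope.

(** A first-order expansion at [x] only sees the germ: the one of [f] also holds for [g], and
    [diff_unique] then identifies the two differentials. *)
Lemma near_eq_differentiable (R : numFieldType) (V W : normedModType R)
    (f g : V -> W) (x : V) :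
  (\near x, f x = g x) -> differentiable f x -> differentiable g x.
Proof.
move=> fg /diff_locallyP[dc df].
have dg : g \o shift x = cst (g x) + 'd f x +o_ 0 id.
  apply/eqaddoP => e e0; move/eqaddoP : df => /(_ e e0) df.
  have fg' : \forall h \near (0 : V), f (h + x) = g (h + x).
    have := fg; rewrite (near_shift 0) /=; apply: filterS => h.
    by rewrite /= subr0.
  near=> h; rewrite /= !fctE /=.
  have -> : g (h + x) = f (h + x) by apply/esym; near: h.
  by rewrite -(nbhs_singleton fg); near: h.
have ddg := diff_unique dc dg.
by apply/diff_locallyP; rewrite ddg.
Unshelve. all: by end_near. Qed.

(** * Calculus of smooth functions *)

Section SmoothTheory.
Variables (R : realType) (V : normedModType R).
Implicit Types (O : set V) (f g : V -> R).

(** Openness of [O] upgrades equality on [O] to equality near each of its points, which is what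
    derivatives require. *)
Lemma Ck_ext m O f g : open O -> (forall x, O x -> f x = g x) ->
  Ck m O f -> Ck m O g.
Proof.
move=> oO; elim: m f g => [|m IH] f g fg /=.
  move=> cf x Ox; have fgx : \near x, f x = g x.
    by apply: filterS (open_nbhs_nbhs (conj oO Ox)).
  rewrite /prop_for /continuous_at -(fg _ Ox).
  exact: cvg_trans (near_eq_cvg fgx) (cf _ Ox).
move=> [df Df]; have fgn x : O x -> \near x, f x = g x.
  by move=> Ox; apply: filterS (open_nbhs_nbhs (conj oO Ox)).
split=> [x Ox|v]; first exact: near_eq_differentiable (fgn x Ox) (df x Ox).
by apply: IH (Df v) => x Ox; exact: near_eq_derive (fgn x Ox).
Qed.

Lemma Ck_sub m O O' f : O' `<=` O -> Ck m O f -> Ck m O' f.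
Proof.
move=> sO; elim: m f => [|m IH] f /=; first by move=> cf x /sO; apply: cf.
by move=> [df Df]; split=> [x /sO|v]; [exact: df|exact: IH].
Qed.

Lemma CkS m O f : Ck m.+1 O f -> Ck m O f.
Proof.
elim: m f => [|m IH] f [df Df]; first by move=> x /df/differentiable_continuous.
by split=> // v; apply: IH (Df v).
Qed.

Lemma Ck_cst m O (c : R) : Ck m O (cst c).
Proof.
elim: m c => [|m IH] c; first by move=> x _; exact: cvg_cst.
split=> [x _|v]; first exact: differentiable_cst.
rewrite (_ : 'D_v (cst c) = cst 0)//.
by apply/funext => x; rewrite derive_cst.
Qed.

Lemma CkD m O f g : open O -> Ck m O f -> Ck m O g ->
  Ck m O (fun x => f x + g x).
Proof.
move=> oO; elim: m f g => [|m IH] f g.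
  by move=> cf cg x Ox; apply: cvgD; [exact: cf|exact: cg].
move=> [df Df] [dg Dg]; split=> [x Ox|v].
  by apply: (@differentiableD _ _ _ f g); [exact: df|exact: dg].
apply: Ck_ext oO _ (IH _ _ (Df v) (Dg v)) => x Ox.
by rewrite -(@deriveD _ _ _ f g)//; apply/diff_derivable; [exact: df|exact: dg].
Qed.

Lemma CkM m O f g : open O -> Ck m O f -> Ck m O g ->
  Ck m O (fun x => f x * g x).
Proof.
move=> oO; elim: m f g => [|m IH] f g.
  by move=> cf cg x Ox; apply: cvgM; [exact: cf|exact: cg].
move=> Cf Cg; have [df Df] := Cf; have [dg Dg] := Cg; split=> [x Ox|v].
  by apply: (@differentiableM _ _ f g); [exact: df|exact: dg].
have := CkD oO (IH _ _ (CkS Cf) (Dg v)) (IH _ _ (CkS Cg) (Df v)).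
apply: Ck_ext oO _ => x Ox.
by rewrite (@deriveM _ _ f g)//; apply/diff_derivable; [exact: df|exact: dg].
Qed.

(** The derivative of [f^-1] is a product of [f^-1], [f^-1] and a derivative of [f], so one order of
    regularity of [f^-1] yields the next. *)
Lemma CkV m O f : open O -> (forall x, O x -> f x != 0) -> Ck m O f ->
  Ck m O (fun x => (f x)^-1).
Proof.
move=> oO f0; elim: m => [|m IH].
  by move=> cf x Ox; apply: cvgV; [exact: f0|exact: cf].
move=> Cf; have [df Df] := Cf; split=> [x Ox|v].
  by apply: differentiableV; [exact: df|exact: f0].
have CV := IH (CkS Cf).
have := CkM oO (Ck_cst m O (-1)) (CkM oO (CkM oO CV CV) (Df v)).
apply: Ck_ext oO _ => x Ox.
rewrite deriveV//; [|exact: f0|exact/diff_derivable/df].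
by rewrite /= mulN1r scaleNr /GRing.scale/= expr2 invfM.
Qed.

Lemma smooth_ext O f g : open O -> (forall x, O x -> f x = g x) ->
  smooth O f -> smooth O g.
Proof. by move=> oO fg sf m; apply: Ck_ext (sf m). Qed.

Lemma smooth_sub O O' f : O' `<=` O -> smooth O f -> smooth O' f.
Proof. by move=> sO sf m; apply: Ck_sub sO (sf m). Qed.

Lemma smooth_cst O (c : R) : smooth O (cst c).
Proof. by move=> m; exact: Ck_cst. Qed.

Lemma smoothD O f g : open O -> smooth O f -> smooth O g ->
  smooth O (fun x => f x + g x).
Proof. by move=> oO sf sg m; exact: CkD. Qed.

Lemma smoothM O f g : open O -> smooth O f -> smooth O g ->
  smooth O (fun x => f x * g x).
Proof. by move=> oO sf sg m; exact: CkM. Qed.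

Lemma smoothN O f : open O -> smooth O f -> smooth O (fun x => - f x).
Proof.
move=> oO sf; apply: smooth_ext oO _ (smoothM oO (smooth_cst O (-1)) sf) => x _.
by rewrite mulN1r.
Qed.

Lemma smoothV O f : open O -> (forall x, O x -> f x != 0) -> smooth O f ->
  smooth O (fun x => (f x)^-1).
Proof. by move=> oO f0 sf m; exact: CkV. Qed.

Lemma smooth_sum O (I : Type) (s : seq I) (F : I -> V -> R) : open O ->
  (forall i, smooth O (F i)) -> smooth O (fun x => \sum_(i <- s) F i x).
Proof.
move=> oO sF; elim: s => [|i s IH].
  by apply: smooth_ext oO _ (smooth_cst O 0) => x _; rewrite big_nil.
by apply: smooth_ext oO _ (smoothD oO (sF i) IH) => x _; rewrite big_cons.
Qed.

Lemma smoothDv O f v : smooth O f -> smooth O ('D_v f).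
Proof. by move=> sf m; exact: (sf m.+1).2. Qed.

Lemma smooth_differentiable O f x : smooth O f -> O x -> differentiable f x.
Proof. by move=> sf Ox; exact: (sf 1%N).1. Qed.

Lemma smooth_derivable O f x v : smooth O f -> O x -> derivable f x v.
Proof. by move=> sf Ox; exact/diff_derivable/(smooth_differentiable sf). Qed.

Lemma smooth_continuous O f x : smooth O f -> O x -> {for x, continuous f}.
Proof. by move=> sf Ox; exact/differentiable_continuous/(smooth_differentiable sf). Qed.

Lemma smooth_linear O (f : {linear V -> R}) : continuous f -> smooth O f.
Proof.
move=> cf [|m]; first by move=> x _; exact: cf.
split=> [x _|v]; first exact/linear_differentiable.
rewrite (_ : 'D_v f = cst (f v)); first exact: Ck_cst.
by apply/funext => x; rewrite deriveE ?diff_lin//; exact/linear_differentiable.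
Qed.

End SmoothTheory.

(** * Chain rules for smooth scalar functions *)

Section Composition.
Variables (R : realType) (V W : normedModType R).

(** ['D_v (f \o A)] is ['D_(A v) f \o A], again a smooth function composed with [A]; hence the
    induction with [f] generalised. *)
Lemma smooth_comp_linear (O : set V) (f : V -> R) (A : {linear W -> V}) :
  continuous A -> open O -> smooth O f -> smooth (A @^-1` O) (f \o A).
Proof.
move=> cA oO sf m; elim: m f sf => [|m IH] f sf.
  by move=> x Ox; apply: continuous_comp; [exact: cA|exact: smooth_continuous sf _].
have dA x : differentiable A x by exact: linear_differentiable.
have dfA x : O (A x) -> differentiable f (A x) by exact: smooth_differentiable sf.
split=> [x Ox|v]; first by apply: differentiable_comp => //; exact: dfA.
have oA : open (A @^-1` O) by apply: open_comp => // x _; exact: cA.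
apply: Ck_ext oA _ (IH _ (smoothDv (A v) sf)) => x Ox.
rewrite [RHS]deriveE; last by apply: differentiable_comp => //; exact: dfA.
by rewrite diff_comp//=; [rewrite diff_lin// deriveE//; exact: dfA|exact: dfA].
Qed.

Variables (I : finType) (e : I -> V).

(** [smooth] concerns scalar functions only, so a map into [V] is presented by scalar coefficients
    [g i] on a fixed finite family [e]; the chain rule then involves only the directional
    derivatives along the [e i]. *)
Lemma derive_comp_frame (g : I -> W -> R) (f : V -> R) (x v : W) :
  (forall i, differentiable (g i) x) ->
  differentiable f (\sum_i g i x *: e i) ->
  differentiable (fun y => f (\sum_i g i y *: e i)) x /\
  'D_v (fun y => f (\sum_i g i y *: e i)) x =
    \sum_i 'D_v (g i) x * 'D_(e i) f (\sum_i g i x *: e i).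
Proof.
move=> dg df; pose G y := \sum_i g i y *: e i.
have GE : G = \sum_i (fun y => g i y *: e i).
  by apply/funext => y; rewrite fct_sumE.
have dG : differentiable G x.
  rewrite GE; elim/big_ind : _ => [||i _]; first exact: differentiable_cst.
    by move=> ? ?; exact: differentiableD.
  exact: differentiableZl.
have DG : 'd G x v = \sum_i 'D_v (g i) x *: e i.
  rewrite -deriveE//.
  have : forall s : seq I, is_derive x v (\sum_(i <- s) (fun y => g i y *: e i))
      (\sum_(i <- s) 'D_v (g i) x *: e i).
    elim=> [|i s IH]; rewrite ?big_nil ?big_cons; first exact: is_derive_cst.
    apply: is_deriveD.
    have dgi : differentiable (fun y => g i y *: e i) x by exact: differentiableZl.
    apply: DeriveDef; first exact: diff_derivable.
    by rewrite deriveE// diffZl// deriveE.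
  by move=> /(_ (index_enum I)) [_]; rewrite -GE.
have dfG : differentiable (f \o G) x by exact: differentiable_comp.
split; first exact: dfG.
rewrite deriveE; last exact: dfG.
rewrite -[X in 'd X _]/(f \o G) diff_comp//= DG linear_sum.
apply: eq_bigr => i _; rewrite linearZ /=; congr (_ * _).
by rewrite deriveE.
Qed.

(** The chain rule expresses the derivative through the functions ['D_(e i) f] composed with the
    same map, so the induction runs over all smooth [f] with [g] fixed. *)
Lemma smooth_comp_frame (O : set V) (O' : set W) (f : V -> R) (g : I -> W -> R) :
  open O' -> (forall y, O' y -> O (\sum_i g i y *: e i)) ->
  smooth O f -> (forall i, smooth O' (g i)) ->
  smooth O' (fun y => f (\sum_i g i y *: e i)).
Proof.
move=> oO' gO + sg m; elim: m f => [|m IH] f sf.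
  move=> y Oy; apply: differentiable_continuous.
  (* The direction [0] is a dummy, since only differentiability is taken. *)
  apply: (derive_comp_frame 0 _ _).1; last exact: (smooth_differentiable sf (gO y Oy)).
  by move=> i; exact: smooth_differentiable (sg i) Oy.
have dgy y : O' y -> forall i, differentiable (g i) y.
  by move=> Oy i; exact: smooth_differentiable (sg i) Oy.
have dfy y (Oy : O' y) := smooth_differentiable sf (gO y Oy).
split=> [y Oy|v]; first exact: (derive_comp_frame 0 (dgy y Oy) (dfy y Oy)).1.
have Cs (s : seq I) : Ck m O' (fun y => \sum_(i <- s)
    'D_v (g i) y * 'D_(e i) f (\sum_j g j y *: e j)).
  elim: s => [|i s Cs].
    by apply: Ck_ext oO' _ (Ck_cst m O' 0) => y _; rewrite big_nil.
  have Ci := CkM oO' (smoothDv v (sg i) m) (IH _ (smoothDv (e i) sf)).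
  by apply: Ck_ext oO' _ (CkD oO' Ci Cs) => y _; rewrite big_cons.
apply: Ck_ext oO' _ (Cs (index_enum I)) => y Oy.
by rewrite (derive_comp_frame v (dgy y Oy) (dfy y Oy)).2.
Qed.

End Composition.

(** * Symmetry of second derivatives *)

Section Schwarz.
Variables (R : realType) (V : normedModType R).

Lemma mvt_line (g : V -> R) (y u : V) (h : R) : 0 < h ->
  (forall s, 0 <= s <= h -> differentiable g (y + s *: u)) ->
  exists2 s, 0 <= s <= h & g (y + h *: u) - g y = 'D_u g (y + s *: u) * h.
Proof.
move=> h0 dg; pose l (s : R) : V := y + s *: u.
have dl s : is_diff s l ( *:%R^~ u).
  have := is_diffD (is_diff_cst y s) (is_diff_scalel s u).
  by rewrite add0r.
have dgl s : 0 <= s <= h -> is_derive s 1 (g \o l) ('D_u g (l s)).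
  move=> sh; have dgls : differentiable g (l s) by exact: dg.
  have dll : differentiable l s by [].
  apply: DeriveDef; first exact/diff_derivable/differentiable_comp.
  rewrite deriveE; last exact: differentiable_comp.
  by rewrite diff_comp//= diff_val scale1r deriveE.
have [||s] := @MVT R (g \o l) (fun s => 'D_u g (l s)) 0 h h0.
- by move=> s /[1!in_itv]/= /andP[s0 sh]; apply: dgl; rewrite !ltW.
- apply: derivable_within_continuous => s /[1!in_itv]/= sh.
  exact: (@ex_derive _ _ _ _ _ _ _ (dgl _ sh)).
rewrite in_itv/= => /andP[s0 sh] E; exists s; first by rewrite !ltW.
by rewrite subr0 /l/= scale0r addr0 in E.
Qed.

(** Two uses of the mean value theorem: along [u] for the first difference
    [y |-> f (y + h *: v) - f y], then along [v] for ['D_u f]. *)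
Lemma second_difference (O : set V) (f : V -> R) (x u v : V) (h : R) :
  smooth O f -> 0 < h ->
  (forall s t, 0 <= s <= h -> 0 <= t <= h -> O (x + s *: u + t *: v)) ->
  exists s t, [/\ 0 <= s <= h, 0 <= t <= h &
    f (x + h *: u + h *: v) - f (x + h *: u) - (f (x + h *: v) - f x) =
      'D_v ('D_u f) (x + s *: u + t *: v) * h * h].
Proof.
move=> sf h0 Oh; pose g y := f (y + h *: v) - f y.
have h00 : 0 <= (0 : R) <= h by rewrite lexx ltW.
have hhh : 0 <= h <= h by rewrite lexx ltW.
have dT y : is_diff y (fun z : V => z + h *: v) id.
  have := is_diffD (is_diff_id y) (is_diff_cst (h *: v) y).
  by rewrite addr0.
have dfT y : O (y + h *: v) -> differentiable (f \o (fun z => z + h *: v)) y.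
  by move=> Oy; apply: differentiable_comp => //; exact: smooth_differentiable sf Oy.
have O0 s : 0 <= s <= h -> O (x + s *: u).
  by move=> sh; have := Oh s 0 sh h00; rewrite scale0r addr0.
have dg s : 0 <= s <= h -> differentiable g (x + s *: u).
  move=> sh; apply: (@differentiableB _ _ _ (f \o (fun z => z + h *: v)) f).
    by apply: dfT; exact: Oh.
  exact: smooth_differentiable sf (O0 _ sh).
have [s sh Es] := mvt_line h0 dg.
have [t th Et] : exists2 t, 0 <= t <= h &
    'D_u f (x + s *: u + h *: v) - 'D_u f (x + s *: u) =
    'D_v ('D_u f) (x + s *: u + t *: v) * h.
  apply: (@mvt_line ('D_u f) (x + s *: u) v h h0) => t th.
  exact: smooth_differentiable (smoothDv u sf) (Oh _ _ sh th).
exists s, t; split; [exact: sh|exact: th|].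
have -> : f (x + h *: u + h *: v) - f (x + h *: u) - (f (x + h *: v) - f x) =
    g (x + h *: u) - g x by [].
rewrite Es -Et; congr (_ * _).
have dfx := smooth_differentiable sf (O0 _ sh).
have dfTx := dfT _ (Oh _ _ sh hhh).
have dfhx := smooth_differentiable sf (Oh _ _ sh hhh).
rewrite -[LHS]/('D_u ((f \o (fun z => z + h *: v)) - f) _).
rewrite deriveB; [|exact: diff_derivable..].
congr (_ - _); rewrite deriveE; last exact: dfTx.
by rewrite diff_comp//= diff_val -deriveE.
Qed.

Lemma small_square (P : set V) (x u v : V) : nbhs x P ->
  exists2 h : R, 0 < h &
    forall s t, 0 <= s <= h -> 0 <= t <= h -> P (x + s *: u + t *: v).
Proof.
move=> /nbhs_ballP[r /= r0 rP]; pose d := 1 + (`|u| + `|v|).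
have d0 : 0 < d by rewrite ltr_wpDr// addr_ge0.
(* This side bounds the displacement by [r / 2], below the radius [r]; the summand [1] keeps [d]
   positive when [u] and [v] vanish. *)
exists (r / 2 / d) => [|s t /andP[s0 sh] /andP[t0 th]].
  by rewrite !divr_gt0.
apply: rP; rewrite -ball_normE /ball_ /= -addrA opprD addNKr normrN.
apply: le_lt_trans (ler_normD _ _) _; rewrite !normrZ !ger0_norm//.
apply: (@le_lt_trans _ _ (r / 2 / d * d)); last first.
  by rewrite divfK ?gt_eqF// ltr_pdivrMr// mulr2n mulrDr mulr1 ltrDl.
rewrite /d !mulrDr mulr1; apply: ler_wpDl; first by rewrite !divr_ge0// ltW.
by rewrite lerD// ler_wpM2r.
Qed.

(** Schwarz's theorem. The second difference of step [h] is symmetric in [u] and [v], so one mixed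
    derivative at some point of the small square equals the other at another such point; by
    continuity each is within [e / 2] of its value at [x]. *)
Lemma derive_derive_comm (O : set V) (f : V -> R) (x u v : V) :
  open O -> smooth O f -> O x -> 'D_v ('D_u f) x = 'D_u ('D_v f) x.
Proof.
move=> oO sf Ox; apply/eqP; rewrite -subr_eq0 -normr_le0.
apply/ler_addgt0Pr => e e0; rewrite add0r.
have e2 : 0 < e / 2 by rewrite divr_gt0.
have near_D a b : \forall y \near x, `|'D_a ('D_b f) x - 'D_a ('D_b f) y| < e / 2.
  have := smooth_continuous (smoothDv a (smoothDv b sf)) Ox.
  by move=> /cvgrPdist_lt; apply.
have [h h0 Ph] := small_square u v (filterI (open_nbhs_nbhs (conj oO Ox))
   (filterI (near_D v u) (near_D u v))).
have Ph1 s t : 0 <= s <= h -> 0 <= t <= h -> O (x + s *: u + t *: v).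
  by move=> sh th; have [] := Ph s t sh th.
have Ph2 s t : 0 <= s <= h -> 0 <= t <= h -> O (x + s *: v + t *: u).
  by move=> sh th; rewrite addrAC; exact: Ph1.
have [s1 [t1 [sh1 th1 E1]]] := second_difference sf h0 Ph1.
have [s2 [t2 [sh2 th2 E2]]] := second_difference sf h0 Ph2.
have [_ [L1 _]] := Ph _ _ sh1 th1.
have [_ [_ L2]] := Ph _ _ th2 sh2.
rewrite addrAC in L2; rewrite [x + h *: v + h *: u]addrAC in E2.
move: L1 L2 E1 E2.
move: ('D_v ('D_u f) (_ + _)) ('D_u ('D_v f) (_ + _)) => B1 B2.
move: ('D_v ('D_u f) x) ('D_u ('D_v f) x) => A1 A2.
move: (f (_ + _ + _)) (f (x + h *: u)) (f (x + h *: v)) (f x) => a b c d L1 L2 E1 E2.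
have B12 : B1 * h * h = B2 * h * h by rewrite -E1 -E2; ring.
have {}B12 : B1 = B2 by apply: (mulIf (lt0r_neq0 h0)); apply: (mulIf (lt0r_neq0 h0)).
have -> : A1 - A2 = (A1 - B1) - (A2 - B2) by rewrite B12; ring.
by apply: le_trans (ler_normB _ _) _; rewrite (splitr e) lerD// ltW.
Qed.

End Schwarz.

(** * Velocity spaces *)

Lemma trunc_trunc (R : realType) (p q r m : nat) (X : 'M[R]_(p.+1, m)) :
  (r <= q)%N -> trunc r (trunc q X) = trunc r X.
Proof.
move=> rq; apply/matrixP => a i; rewrite !mxE; congr (X _ _).
by rewrite inordK// (leq_trans (ltn_ord a)).
Qed.

Lemma trunc_id (R : realType) (r m : nat) (X : 'M[R]_(r.+1, m)) : trunc r X = X.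
Proof. by apply/matrixP => a i; rewrite mxE inord_val. Qed.

Lemma trunc_is_linear (R : realType) (q r m : nat) :
  linear (@trunc R q r m).
Proof. by move=> c X Y; apply/matrixP => a i; rewrite !mxE. Qed.

HB.instance Definition _ (R : realType) (q r m : nat) :=
  GRing.isLinear.Build R _ _ _ (@trunc R q r m) (@trunc_is_linear R q r m).

(** The matrix norm is a maximum over finitely many entries, and finitely many neighbourhoods of [x]
    have a common one. *)
Lemma matrix_continuous (R : realType) (T : topologicalType) (m p : nat)
    (f : T -> 'M[R]_(m, p)) :
  (forall i j, continuous (fun x => f x i j)) -> continuous f.
Proof.
move=> cf x; apply/cvgrPdist_le => e e0.
have : \forall y \near x, forall ij : 'I_m * 'I_p,
    `|f x ij.1 ij.2 - f y ij.1 ij.2| <= e.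
  apply: filter_forall => -[i j] /=.
  by have /cvgrPdist_le := cf i j x; apply.
apply: filterS => y fy; rewrite /Num.Def.normr/= mx_normrE.
by apply: bigmax_le => [|[i j] _ /=]; [exact: ltW|rewrite !mxE; exact: (fy (i, j))].
Qed.

Lemma trunc_continuous (R : realType) (q r m : nat) : continuous (@trunc R q r m).
Proof.
apply: matrix_continuous => i j; under eq_fun do rewrite mxE.
exact: coord_continuous.
Qed.

(** The entry map receives a name so that a linear structure can be attached to it. *)
Definition mxcoord (R : realType) (m p : nat) (i : 'I_m) (j : 'I_p)
  (X : 'M[R]_(m, p)) : R := X i j.

Lemma mxcoord_is_linear (R : realType) (m p : nat) (i : 'I_m) (j : 'I_p) :
  linear (@mxcoord R m p i j).
Proof. by move=> c X Y; rewrite /mxcoord !mxE. Qed.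

HB.instance Definition _ (R : realType) (m p : nat) (i : 'I_m) (j : 'I_p) :=
  GRing.isLinear.Build R _ _ _ (@mxcoord R m p i j) (@mxcoord_is_linear R m p i j).

Lemma mxcoord_continuous (R : realType) (m p : nat) (i : 'I_m) (j : 'I_p) :
  continuous (@mxcoord R m p i j).
Proof. exact: coord_continuous. Qed.

Lemma smooth_coord (R : realType) (m p : nat) (O : set 'M[R]_(m, p)) i j :
  smooth O (fun X : 'M[R]_(m, p) => X i j).
Proof. exact: (smooth_linear O (@mxcoord_continuous R m p i j)). Qed.

Lemma derive_coord (R : realType) (m p : nat) (X H : 'M[R]_(m, p)) i j :
  'D_H (fun X : 'M[R]_(m, p) => X i j) X = H i j.
Proof.
have cf := @mxcoord_continuous R m p i j.
rewrite -[LHS]/('D_H (@mxcoord R m p i j) X) deriveE; last exact: linear_differentiable.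
by rewrite diff_lin.
Qed.

Section VelocitySpaces.
Variables (R : realType) (n : nat).

Lemma open_trunc (q r : nat) (O : set (vel R n r)) :
  open O -> open [set w : vel R n q | O (trunc r w)].
Proof. by move=> oO; apply: open_comp => // x _; exact: trunc_continuous. Qed.

Lemma smooth_trunc (q r : nat) (O : set (vel R n r)) (F : vel R n r -> R) :
  open O -> smooth O F ->
  smooth [set w : vel R n q | O (trunc r w)] (fun w => F (trunc r w)).
Proof.
move=> oO sF; exact: (smooth_comp_linear (@trunc_continuous R q r n.+1) oO sF).
Qed.

Lemma derive_trunc (q r : nat) (O : set (vel R n r)) (F : vel R n r -> R)
    (w h : vel R n q) : smooth O F -> O (trunc r w) ->
  'D_h (fun w => F (trunc r w)) w = 'D_(trunc r h) F (trunc r w).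
Proof.
move=> sF Ow; have dF := smooth_differentiable sF Ow.
have cT := @trunc_continuous R q r n.+1.
have dT : differentiable (@trunc R q r n.+1) w by exact: linear_differentiable.
rewrite deriveE; last exact: (differentiable_comp dT dF).
by rewrite -[X in diff _ X]/(F \o @trunc R q r n.+1) diff_comp//= diff_lin// deriveE.
Qed.

(** For [w] the velocity of a curve, [vel_shift w] is the tangent vector of the prolonged curve at
    [trunc r w]; the total derivative is differentiation in this direction. *)
Definition vel_shift (r : nat) (h : vel R n r.+1) : vel R n r :=
  \matrix_(a, al) h (lift ord0 a) al.

Lemma vtotalE (r : nat) (F : vel R n r -> R) (w : vel R n r.+1) :
  vtotal F w = \sum_(p : 'I_r.+1 * 'I_n.+1)
    w (lift ord0 p.1) p.2 * 'D_(delta_mx p.1 p.2) F (trunc r w).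
Proof. by rewrite /vtotal pair_big. Qed.

Lemma derive_delta (r : nat) (F : vel R n r -> R) (w h : vel R n r) :
  differentiable F w ->
  'D_h F w = \sum_(p : 'I_r.+1 * 'I_n.+1) h p.1 p.2 * 'D_(delta_mx p.1 p.2) F w.
Proof.
move=> dF; rewrite deriveE// [in LHS](matrix_sum_delta h) pair_big/= linear_sum.
by apply: eq_bigr => p _; rewrite linearZ/= deriveE.
Qed.

Lemma smooth_vtotal (r : nat) (O : set (vel R n r)) (F : vel R n r -> R) :
  open O -> smooth O F ->
  smooth [set w : vel R n r.+1 | O (trunc r w)] (vtotal F).
Proof.
move=> oO sF; have oO' := @open_trunc r.+1 _ _ oO.
have sum_smooth : smooth [set w : vel R n r.+1 | O (trunc r w)]
    (fun w => \sum_(p : 'I_r.+1 * 'I_n.+1)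
      w (lift ord0 p.1) p.2 * 'D_(delta_mx p.1 p.2) F (trunc r w)).
  apply: smooth_sum => // p; apply: smoothM => //; first exact: smooth_coord.
  exact: (@smooth_trunc r.+1 _ _ _ oO (smoothDv _ sF)).
by apply: smooth_ext oO' _ sum_smooth => w _; rewrite vtotalE.
Qed.

(** The commutator of ['D_h] with the total derivative: differentiating the coefficients
    [w (lift ord0 a) al] gives the shifted direction, and symmetry of second derivatives moves
    ['D_h] under [vtotal] in the rest. *)
Lemma derive_vtotal (r : nat) (O : set (vel R n r)) (F : vel R n r -> R)
    (w h : vel R n r.+1) : open O -> smooth O F -> O (trunc r w) ->
  'D_h (vtotal F) w =
    'D_(vel_shift h) F (trunc r w) + vtotal ('D_(trunc r h) F) w.
Proof.
move=> oO sF Ow; have oO' := @open_trunc r.+1 _ _ oO.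
pose t (p : 'I_r.+1 * 'I_n.+1) (w : vel R n r.+1) :=
  w (lift ord0 p.1) p.2 * 'D_(delta_mx p.1 p.2) F (trunc r w).
have Dt p : is_derive w h (t p) (h (lift ord0 p.1) p.2 *
    'D_(delta_mx p.1 p.2) F (trunc r w) +
    w (lift ord0 p.1) p.2 * 'D_(delta_mx p.1 p.2) ('D_(trunc r h) F) (trunc r w)).
  have s1 := @smooth_coord R _ _ [set w : vel R n r.+1 | O (trunc r w)] (lift ord0 p.1) p.2.
  have s2 := @smooth_trunc r.+1 _ _ _ oO (smoothDv (delta_mx p.1 p.2) sF).
  have d1 := @smooth_derivable _ _ _ _ _ h s1 Ow; have d2 := @smooth_derivable _ _ _ _ _ h s2 Ow.
  apply: DeriveDef; first exact: (derivableM d1 d2).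
  rewrite (deriveM d1 d2) derive_coord (derive_trunc _ (smoothDv _ sF) Ow).
  by rewrite (derive_derive_comm _ _ oO sF Ow) addrC /GRing.scale/= [X in X + _]mulrC.
have Ds : forall s : seq ('I_r.+1 * 'I_n.+1), is_derive w h
   (fun w => \sum_(p <- s) t p w) (\sum_(p <- s) (h (lift ord0 p.1) p.2 *
    'D_(delta_mx p.1 p.2) F (trunc r w) +
    w (lift ord0 p.1) p.2 * 'D_(delta_mx p.1 p.2) ('D_(trunc r h) F) (trunc r w))).
  elim=> [|p s IH].
    rewrite big_nil (_ : (fun _ => _) = cst 0); first exact: is_derive_cst.
    by apply/funext => y; rewrite big_nil.
  rewrite big_cons (_ : (fun _ => _) = t p + (fun w => \sum_(p <- s) t p w)).
    exact: is_deriveD.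
  by apply/funext => y; rewrite big_cons.
rewrite (_ : vtotal F = fun w => \sum_p t p w); last first.
  by apply/funext => y; rewrite vtotalE.
have [_ ->] := Ds (index_enum _); rewrite big_split/=; congr (_ + _).
  rewrite derive_delta; last exact: smooth_differentiable sF Ow.
  by apply: eq_bigr => p _; rewrite mxE.
by rewrite vtotalE.
Qed.

Lemma smooth_vtotaln (m r : nat) (O : set (vel R n r)) (F : vel R n r -> R) :
  open O -> smooth O F ->
  smooth [set w : vel R n (m + r) | O (trunc r w)] (vtotaln m F).
Proof.
move=> oO sF; elim: m => [|m IH].
  by apply: smooth_sub sF => w /=; rewrite trunc_id.
apply: smooth_sub (smooth_vtotal (@open_trunc (m + r) _ _ oO) IH) => w /=.
by rewrite trunc_trunc// leq_addl.
Qed.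

Lemma tdot_trunc (q r : nat) (w : vel R n q) : (0 < r)%N ->
  tdot (trunc r w) = tdot w.
Proof. by move=> r0; rewrite /tdot /uvel mxE inordK. Qed.

(* [tdot] is a junk value at order [0]. *)
Definition vreg (r : nat) : set (vel R n r) :=
  [set w | (0 < r)%N -> tdot w != 0].
#[global] Arguments vreg r _ : clear implicits.

Lemma open_tdot_neq0 (r : nat) : open [set w : vel R n r | tdot w != 0].
Proof.
apply: (@open_comp _ _ (fun w : vel R n r => tdot w) [set x | x != 0]).
  by move=> w _; exact: coord_continuous.
exact: open_neq.
Qed.

Lemma open_vreg (r : nat) : open (vreg r).
Proof.
case: r => [|r].
  by rewrite (_ : vreg 0 = setT); [exact: openT|apply/seteqP; split].
rewrite (_ : vreg r.+1 = [set w | tdot w != 0]); first exact: open_tdot_neq0.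
by apply/seteqP; split=> w; [exact|move=> ? _].
Qed.

Lemma vreg_trunc (q r : nat) (w : vel R n q) : (r <= q)%N ->
  vreg q w -> vreg r (trunc r w).
Proof.
move=> rq wq r0; rewrite tdot_trunc//; apply: wq; exact: leq_trans rq.
Qed.

Lemma smooth_tderiv (a : nat) (i : 'I_n) : smooth (vreg a) (@tderiv R n a i).
Proof.
elim: a => [|a IH]; first exact: smooth_coord.
apply: smoothM; first exact: open_vreg.
  apply: smoothV; [exact: open_vreg|by move=> w; exact|exact: smooth_coord].
apply: smooth_sub (smooth_vtotal (@open_vreg a) IH) => w.
exact: vreg_trunc.
Qed.

(** The quotient rule combined with [derive_vtotal]. In the term coming from [(tdot w)^-1], one
    inverse factor is absorbed together with [vtotal] into [tderiv i w]; this is the source of the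
    correction term in the recursion for [l_b]. *)
Lemma derive_tderivS (a : nat) (i : 'I_n) (w h : vel R n a.+1) :
  tdot w != 0 ->
  'D_h (@tderiv R n a.+1 i) w = (tdot w)^-1 *
    ('D_(vel_shift h) (@tderiv R n a i) (trunc a w) +
     vtotal ('D_(trunc a h) (@tderiv R n a i)) w)
    - tdot h * (tdot w)^-1 * tderiv i w.
Proof.
move=> w0; have wr : vreg a.+1 w by [].
have st : smooth (vreg a.+1) (@tdot R n a.+1) by exact: smooth_coord.
have dt := @smooth_derivable _ _ _ _ _ h st wr.
have sv : smooth (vreg a.+1) (vtotal (@tderiv R n a i)).
  apply: smooth_sub (smooth_vtotal (@open_vreg a) (@smooth_tderiv a i)) => ?.
  exact: vreg_trunc.
have dv := @smooth_derivable _ _ _ _ _ h sv wr.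
have dV : derivable (fun w => (tdot w)^-1) w h by exact: (derivableV w0 dt).
have DV : 'D_h (fun w => (tdot w)^-1) w = - (tdot w) ^- 2 *: 'D_h (@tdot R n a.+1) w.
  exact: deriveV w0 dt.
have -> : 'D_h (@tderiv R n a.+1 i) w = (tdot w)^-1 *: 'D_h (vtotal (@tderiv R n a i)) w +
    vtotal (@tderiv R n a i) w *: 'D_h (fun w => (tdot w)^-1) w.
  exact: deriveM dV dv.
rewrite {}DV.
rewrite (derive_vtotal h (@open_vreg a) (@smooth_tderiv a i)); last exact: vreg_trunc.
have -> : 'D_h (@tdot R n a.+1) w = tdot h by exact: derive_coord.
rewrite /GRing.scale/=; congr (_ + _).
rewrite /=; move: (vtotal _ w) (tdot w) (tdot h) w0 => A t b t0.
by field.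
Qed.

End VelocitySpaces.

(** * Jet spaces and the projection [wp] *)

Section JetSpaces.
Variables (R : realType) (n : nat).

(** A basis of the product space over a single finite index type, as composition with a frame
    requires; [inl] is the direction of [t]. *)
Definition jet_frame (r : nat) (p : 'I_1 + 'I_r.+1 * 'I_n) : jet R n r :=
  match p with
  | inl _ => (1, 0)
  | inr q => (0, delta_mx q.1 q.2)
  end.

Definition jet_coord (r : nat) (j : jet R n r) (p : 'I_1 + 'I_r.+1 * 'I_n) : R :=
  match p with inl _ => j.1 | inr q => j.2 q.1 q.2 end.

Lemma jet_frameE (r : nat) (j : jet R n r) :
  \sum_p jet_coord j p *: jet_frame p = j.
Proof.
rewrite big_sumType big_ord1 /=.
have -> : \sum_(p : 'I_r.+1 * 'I_n) j.2 p.1 p.2 *: ((0, delta_mx p.1 p.2) : jet R n r) =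
    (0, \sum_(p : 'I_r.+1 * 'I_n) j.2 p.1 p.2 *: delta_mx p.1 p.2).
  elim: (index_enum _) => [|p s IH]; first by rewrite !big_nil.
  rewrite !big_cons IH; congr pair => /=.
  by rewrite scaler0 addr0.
rewrite -(pair_big xpredT xpredT (fun a i => j.2 a i *: delta_mx a i))/=.
rewrite -matrix_sum_delta; case: j => t x /=.
congr pair => /=; first by rewrite addr0 /GRing.scale/= mulr1.
by rewrite scaler0 add0r.
Qed.

Lemma jtrunc_is_linear (q r : nat) : linear (@jtrunc R n q r).
Proof. by move=> c x y; rewrite /jtrunc/= linearP. Qed.

HB.instance Definition _ (q r : nat) :=
  GRing.isLinear.Build R _ _ _ (@jtrunc R n q r) (@jtrunc_is_linear q r).

Lemma jtrunc_continuous (q r : nat) : continuous (@jtrunc R n q r).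
Proof.
move=> j.
have c1 : (fun j : jet R n q => j.1) x @[x --> j] --> j.1 by exact: cvg_fst.
have c2 : (fun j : jet R n q => trunc r j.2) x @[x --> j] --> trunc r j.2.
  by apply: continuous_comp; [exact: cvg_snd|exact: trunc_continuous].
exact: cvg_pair c1 c2.
Qed.

Definition jet_entry (r : nat) (a : 'I_r.+1) (i : 'I_n) (j : jet R n r) : R := j.2 a i.

Lemma jet_entry_is_linear (r : nat) (a : 'I_r.+1) (i : 'I_n) : linear (jet_entry a i).
Proof. by move=> c x y; rewrite /jet_entry /= !mxE. Qed.

HB.instance Definition _ (r : nat) (a : 'I_r.+1) (i : 'I_n) :=
  GRing.isLinear.Build R _ _ _ (jet_entry a i) (@jet_entry_is_linear r a i).

Lemma smooth_jet_entry (r : nat) (O : set (jet R n r)) (a : 'I_r.+1) (i : 'I_n) :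
  smooth O (fun j : jet R n r => j.2 a i).
Proof.
have c : continuous (jet_entry a i).
  move=> j; apply: (continuous_comp (g := fun X : 'M[R]_(r.+1, n) => X a i)).
    exact: cvg_snd.
  exact: coord_continuous.
exact: (smooth_linear O c).
Qed.

Variable U : set 'rV[R]_n.
Hypothesis oU : open U.

Lemma open_jet_over (r : nat) : open (jet_over U r).
Proof.
apply: (@open_comp _ _ (fun j : jet R n r => row ord0 j.2) U) => // j _.
move: j; apply: matrix_continuous => i k; under eq_fun do rewrite mxE.
move=> j; apply: (continuous_comp (g := fun X : 'M[R]_(r.+1, n) => X ord0 k)).
  exact: cvg_snd.
exact: coord_continuous.
Qed.

Lemma open_vel_over (r : nat) : open (vel_over U r).
Proof.
apply: (@open_comp _ _ (fun w : vel R n r => \row_i w ord0 (lift ord0 i)) U) => // j _.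
move: j; apply: matrix_continuous => i k; under eq_fun do rewrite mxE.
exact: coord_continuous.
Qed.

Lemma jet_over_jtrunc (q r : nat) (j : jet R n q) :
  jet_over U r (jtrunc r j) = jet_over U q j.
Proof.
rewrite /jet_over /=; congr U; apply/rowP => i; rewrite !mxE.
by congr (j.2 _ _); apply/val_inj; rewrite /= inordK.
Qed.

Lemma vel_over_trunc (q r : nat) (w : vel R n q) :
  vel_over U r (trunc r w) = vel_over U q w.
Proof.
rewrite /vel_over /=; congr U; apply/rowP => i; rewrite !mxE.
by congr (w _ _); apply/val_inj; rewrite /= inordK.
Qed.

Lemma smooth_jtrunc (q r : nat) (F : jet R n r -> R) :
  smooth (jet_over U r) F -> smooth (jet_over U q) (fun j => F (jtrunc r j)).
Proof.
move=> sF; have := smooth_comp_linear (@jtrunc_continuous q r) (@open_jet_over r) sF.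
by apply: smooth_sub => j; rewrite /preimage/= jet_over_jtrunc.
Qed.

Lemma smooth_jtotal (r : nat) (F : jet R n r -> R) :
  smooth (jet_over U r) F -> smooth (jet_over U r.+1) (jtotal F).
Proof.
move=> sF; have oO := @open_jet_over r.+1.
apply: (smoothD oO); first exact: (@smooth_jtrunc r.+1 _ _ (smoothDv _ sF)).
apply: (smooth_sum _ oO) => a; apply: (smooth_sum _ oO) => i.
apply: (smoothM oO); first exact: smooth_jet_entry.
exact: (@smooth_jtrunc r.+1 _ _ (smoothDv _ sF)).
Qed.

Lemma smooth_jtotaln (m r : nat) (F : jet R n r -> R) :
  smooth (jet_over U r) F -> smooth (jet_over U (m + r)) (jtotaln m F).
Proof. by move=> sF; elim: m => [//|m IH]; exact: smooth_jtotal. Qed.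

(** Row [a] of [wp w] depends only on the velocities of order at most [a]. *)
Lemma jtrunc_wp (q r : nat) (w : vel R n q) : (r <= q)%N ->
  jtrunc r (wp w) = wp (trunc r w).
Proof.
move=> rq; rewrite /jtrunc /wp /=; congr pair.
  by rewrite mxE; congr (w _ _); apply/val_inj; rewrite /= inordK.
apply/matrixP => a i; rewrite !mxE inordK ?(leq_trans (ltn_ord a))//.
by rewrite trunc_trunc// -ltnS.
Qed.

Lemma row_wp (r : nat) (w : vel R n r) :
  row ord0 (wp w).2 = \row_i w ord0 (lift ord0 i).
Proof.
by apply/rowP => i; rewrite !mxE/= mxE; congr (w _ _); apply/val_inj; rewrite /= inordK.
Qed.

Lemma jet_over_wp (r : nat) (w : vel R n r) : jet_over U r (wp w) = vel_over U r w.
Proof. by rewrite /jet_over /= row_wp. Qed.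

(** The open domain over the chart on which [wp] is smooth. *)
Definition vdom (r : nat) : set (vel R n r) := vel_over U r `&` vreg r.
#[global] Arguments vdom r _ : clear implicits.

Lemma open_vdom (r : nat) : open (vdom r).
Proof. by apply: openI; [exact: open_vel_over|exact: open_vreg]. Qed.

Lemma smooth_tderiv_trunc (r a : nat) (i : 'I_n) : (a <= r)%N ->
  smooth (vreg r) (fun w : vel R n r => tderiv i (trunc a w)).
Proof.
move=> ar; have st := @smooth_trunc R n r a _ _ (@open_vreg R n a) (@smooth_tderiv R n a i).
apply: smooth_sub st.
by move=> w; exact: vreg_trunc.
Qed.

Lemma smooth_jet_coord_wp (r : nat) (p : 'I_1 + 'I_r.+1 * 'I_n) :
  smooth (vdom r) (fun w : vel R n r => jet_coord (wp w) p).
Proof.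
case: p => [p|[a i]]; first exact: smooth_coord.
have st := @smooth_tderiv_trunc r a i (ltn_ord a).
apply: smooth_ext (@open_vdom r) _ (smooth_sub _ st) => [w _|w []//].
by rewrite /= mxE.
Qed.

Lemma comp_wpE (r : nat) (F : jet R n r -> R) :
  (fun w : vel R n r => F (wp w)) =
  (fun w => F (\sum_p jet_coord (wp w) p *: jet_frame p)).
Proof. by apply/funext => w; rewrite jet_frameE. Qed.

Lemma smooth_wp (r : nat) (F : jet R n r -> R) :
  smooth (jet_over U r) F -> smooth (vdom r) (fun w => F (wp w)).
Proof.
move=> sF; rewrite comp_wpE.
apply: smooth_comp_frame (@open_vdom r) _ sF (@smooth_jet_coord_wp r).
by move=> w [Uw _]; rewrite jet_frameE jet_over_wp.
Qed.

(** The chain rule in the frame of the jet space; row [a] is differentiated on velocities of order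
    [a], where the recursion for [tderiv] lives. *)
Lemma derive_wp (r : nat) (F : jet R n r -> R) (w h : vel R n r) :
  smooth (jet_over U r) F -> vdom r w ->
  'D_h (fun w => F (wp w)) w = h ord0 ord0 * jpartial_t F (wp w) +
    \sum_(a < r.+1) \sum_(i < n)
      'D_(trunc a h) (@tderiv R n a i) (trunc a w) * jpartial a i F (wp w).
Proof.
move=> sF Ow; rewrite comp_wpE.
rewrite (derive_comp_frame h _ _).2; last first.
- rewrite jet_frameE; apply: smooth_differentiable sF _; rewrite jet_over_wp.
  by case: Ow.
- by move=> p; exact: smooth_differentiable (@smooth_jet_coord_wp r p) Ow.
rewrite jet_frameE big_sumType big_ord1 /=; congr (_ * _ + _).
  exact: derive_coord.
rewrite pair_big/=; apply: eq_bigr => -[a i] _ /=; congr (_ * _).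
rewrite -(@derive_trunc R n r a (vreg a) _ w h (@smooth_tderiv R n a i)).
  by congr (derive _ _ _); apply/funext => y; rewrite mxE.
by case: Ow => _; apply: vreg_trunc; exact: ltn_ord a.
Qed.

Lemma vtotal_shift (r : nat) (F : vel R n r -> R) (w : vel R n r.+1) :
  differentiable F (trunc r w) -> vtotal F w = 'D_(vel_shift w) F (trunc r w).
Proof.
move=> dF; rewrite vtotalE derive_delta//.
by apply: eq_bigr => p _; rewrite mxE.
Qed.

Lemma trunc_vel_shift (r a : nat) (w : vel R n r.+1) : (a <= r)%N ->
  trunc a (vel_shift w) = vel_shift (trunc a.+1 w).
Proof.
move=> ar; apply/matrixP => b al; rewrite !mxE; congr (w _ _).
have br : (b <= r)%N by rewrite (leq_trans _ ar)// -ltnS.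
by apply/val_inj; rewrite /= inordK// inordK.
Qed.

Lemma tdotE (r : nat) (w : vel R n r.+1) : tdot w = w (lift ord0 ord0) ord0.
Proof. by congr (w _ _); apply/val_inj; rewrite /= inordK. Qed.

(** [wp] carries [d/dzeta] to [tdot] times [d/dt]: by construction, the total derivative of [tderiv]
    of order [a] is [tdot] times that of order [a.+1]. *)
Lemma vtotal_wp (r : nat) (F : jet R n r -> R) (w : vel R n r.+1) :
  smooth (jet_over U r) F -> vel_over U r.+1 w -> tdot w != 0 ->
  vtotal (fun w => F (wp w)) w = tdot w * jtotal F (wp w).
Proof.
move=> sF Uw w0.
have vr a : (a <= r.+1)%N -> vreg a (trunc a w) by move=> ar; exact: vreg_trunc.
have Ow : vdom r (trunc r w) by split; [rewrite vel_over_trunc|exact: vr].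
rewrite vtotal_shift; last exact: smooth_differentiable (smooth_wp sF) Ow.
rewrite (derive_wp _ sF Ow) /jtotal jtrunc_wp// mulrDr mxE -tdotE; congr (_ + _).
rewrite mulr_sumr; apply: eq_bigr => a _.
rewrite mulr_sumr; apply: eq_bigr => i _; rewrite mulrA; congr (_ * _).
have ar : (a <= r)%N by exact: ltn_ord a.
rewrite trunc_trunc// trunc_vel_shift// !mxE.
(* Going up to [trunc a.+1 w] lets the directional derivative be read back as the [vtotal] that
   occurs in [tderiv] of order [a.+1]. *)
rewrite -[trunc a w](@trunc_trunc _ _ a.+1)// -vtotal_shift; last first.
  rewrite trunc_trunc//; apply: smooth_differentiable (@smooth_tderiv R n a i) _.
  exact/vr/leqW.
rewrite [tderiv i _]/= tdot_trunc// mulrA divff// mul1r.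
by [].
Qed.

End JetSpaces.

(** * Formal adjoints in one variable *)

Section OneVariable.
Variables (R : realType) (I : set R).
Hypothesis oI : open I.
Implicit Types f g : R -> R.

Lemma smooth_derive1 f : smooth I f -> smooth I (derive1 f).
Proof.
move=> sf; have -> : derive1 f = 'D_1 f by apply/funext => z; rewrite derive1E.
exact: smoothDv.
Qed.

Lemma smooth_derive1n a f : smooth I f -> smooth I (derive1n a f).
Proof.
by move=> sf; elim: a => [//|a IH]; rewrite derive1nS; exact: smooth_derive1.
Qed.

Lemma derive1_ext f g : (forall z, I z -> f z = g z) ->
  forall z, I z -> derive1 f z = derive1 g z.
Proof.
move=> fg z Iz; rewrite !derive1E; apply: near_eq_derive.
exact: filterS (open_nbhs_nbhs (conj oI Iz)).
Qed.

Lemma derive1n_ext a f g : (forall z, I z -> f z = g z) ->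
  forall z, I z -> derive1n a f z = derive1n a g z.
Proof. by move=> fg; elim: a => [//|a IH] z Iz; rewrite !derive1nS; exact: derive1_ext. Qed.

Lemma derive1D f g z : smooth I f -> smooth I g -> I z ->
  derive1 (fun y => f y + g y) z = derive1 f z + derive1 g z.
Proof.
move=> sf sg Iz; rewrite !derive1E -[X in derive X]/(f + g) deriveD//.
  exact: smooth_derivable sf Iz.
exact: smooth_derivable sg Iz.
Qed.

Lemma derive1_mul f g z : smooth I f -> smooth I g -> I z ->
  derive1 (fun y => f y * g y) z = f z * derive1 g z + derive1 f z * g z.
Proof.
move=> sf sg Iz; rewrite !derive1E -[X in derive X]/(f * g).
rewrite deriveM; [|exact: smooth_derivable sf Iz|exact: smooth_derivable sg Iz].
by rewrite /GRing.scale/= [g z * _]mulrC.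
Qed.

Lemma derive1_scal c f z : smooth I f -> I z ->
  derive1 (fun y => c * f y) z = c * derive1 f z.
Proof.
move=> sf Iz; have sc : smooth I (cst c : R -> R) by exact: smooth_cst.
by rewrite (derive1_mul sc sf Iz) derive1_cst mul0r addr0.
Qed.

Lemma derive1nD a f g z : smooth I f -> smooth I g -> I z ->
  derive1n a (fun y => f y + g y) z = derive1n a f z + derive1n a g z.
Proof.
move=> sf sg; elim: a z => [//|a IH] z Iz; rewrite !derive1nS (derive1_ext IH Iz).
by apply: derive1D => //; exact: smooth_derive1n.
Qed.

Lemma derive1n_scal a c f z : smooth I f -> I z ->
  derive1n a (fun y => c * f y) z = c * derive1n a f z.
Proof.
move=> sf; elim: a z => [//|a IH] z Iz; rewrite !derive1nS (derive1_ext IH Iz).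
by apply: derive1_scal => //; exact: smooth_derive1n.
Qed.

Lemma derive1n_0 a z : derive1n a (fun=> 0 : R) z = 0.
Proof.
elim: a z => [//|a IH] z; rewrite derive1nS.
by rewrite (_ : derive1n a _ = cst 0) ?derive1_cst//; apply/funext.
Qed.

Lemma derive1n_sum (J : Type) (s : seq J) a (F : J -> R -> R) z :
  (forall j, smooth I (F j)) -> I z ->
  derive1n a (fun y => \sum_(j <- s) F j y) z = \sum_(j <- s) derive1n a (F j) z.
Proof.
move=> sF Iz; elim: s => [|j s IH].
  rewrite big_nil -[RHS](derive1n_0 a z).
  by apply: derive1n_ext Iz => y _; rewrite big_nil.
rewrite big_cons -IH -derive1nD//; last by apply: smooth_sum.
by apply: derive1n_ext Iz => y _; rewrite big_cons.
Qed.

(* The formal adjoint of [\sum_(a < N) P a D^a], applied to [psi]. *)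
Definition adj (N : nat) (P : nat -> R -> R) (psi : R -> R) : R -> R :=
  fun z => \sum_(a < N) (-1) ^+ a * derive1n a (fun y => psi y * P a y) z.

Lemma adj_ext N P Q phi psi z :
  (forall a z, I z -> phi z * P a z = psi z * Q a z) -> I z ->
  adj N P phi z = adj N Q psi z.
Proof.
move=> PQ Iz; apply: eq_bigr => a _; congr (_ * _).
by apply: derive1n_ext Iz => y; exact: PQ.
Qed.

Lemma adjD N P Q psi z : (forall a, smooth I (P a)) ->
  (forall a, smooth I (Q a)) -> smooth I psi -> I z ->
  adj N (fun a y => P a y + Q a y) psi z = adj N P psi z + adj N Q psi z.
Proof.
move=> sP sQ sp Iz; rewrite /adj -big_split/=; apply: eq_bigr => a _.
rewrite -mulrDr; congr (_ * _); rewrite -derive1nD//; [|exact: smoothM..].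
by apply: derive1n_ext Iz => y _; rewrite mulrDr.
Qed.

(* The adjoint of [tau D o P] is the adjoint of [P] composed with
   [psi |-> - (tau psi)'].  [P N = 0] makes the truncation at order [N] exact. *)
Lemma adj_step N P P' (tau psi : R -> R) z :
  (forall a, smooth I (P a)) -> smooth I tau -> smooth I psi ->
  (forall z, I z -> P' 0%N z = tau z * derive1 (P 0%N) z) ->
  (forall a z, I z -> P' a.+1 z = tau z * (derive1 (P a.+1) z + P a z)) ->
  (forall z, I z -> P N z = 0) -> I z ->
  adj N.+1 P' psi z =
    adj N.+1 P (fun y => - derive1 (fun x => tau x * psi x) y) z.
Proof.
move=> sP st sp P'0 P'S PN Iz; pose phi x := tau x * psi x.
have sphi : smooth I phi by exact: smoothM.
have sm1 a : smooth I (fun y => phi y * derive1 (P a) y).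
  by apply: smoothM => //; exact: smooth_derive1.
have sm2 a : smooth I (fun y => phi y * P a y) by exact: smoothM.
(* The recursion for [P'] splits the summand [C] into a part [A] from differentiated coefficients
   and a part [B] whose index is shifted by one. *)
pose A a := (-1) ^+ a * derive1n a (fun y => phi y * derive1 (P a) y) z.
pose B a := (-1) ^+ a.+1 * derive1n a.+1 (fun y => phi y * P a y) z.
pose C a := (-1) ^+ a * derive1n a (fun y => psi y * P' a y) z.
have recl (F : nat -> R) : \sum_(a < N.+1) F a = F 0%N + \sum_(a < N) F a.+1.
  by rewrite big_ord_recl.
have C0 : C 0%N = A 0%N.
  by rewrite /C /A !expr0 !mul1r /derive1n/= P'0// /phi mulrA [psi z * _]mulrC.
have CS a : C a.+1 = A a.+1 + B a.
  rewrite /C /A /B -mulrDr; congr (_ * _).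
  rewrite -(derive1nD _ (sm1 _) (sm2 _) Iz); apply: derive1n_ext Iz => y Iy.
  by rewrite P'S// /phi; ring.
have BN : B N = 0.
  rewrite -[RHS](mulr0 ((-1) ^+ N.+1)) /B; congr (_ * _).
  rewrite -[RHS](derive1n_0 N.+1 z); apply: derive1n_ext Iz => y Iy.
  by rewrite PN// mulr0.
(* Adding the zero term [B N] lets both sums run over the same range. *)
have -> : adj N.+1 P' psi z = \sum_(a < N.+1) A a + \sum_(a < N.+1) B a.
  rewrite [X in _ + X]big_ord_recr [X in _ + (_ + X)]BN Monoid.mulm1.
  rewrite recl -[LHS]/(\sum_(a < N.+1) C a) recl C0 -addrA -big_split/=.
  by congr (_ + _); apply: eq_bigr => a _; exact: CS.
(* Under the [a] outer derivatives, [phi * (P a)' - (phi * P a)' = - phi' * P a]. *)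
rewrite -big_split/=; apply: eq_bigr => a _.
rewrite /A /B derive1Sn exprS mulN1r mulNr -mulrN -mulrDr; congr (_ * _).
rewrite -mulN1r -derive1n_scal//; last exact: smooth_derive1.
rewrite -derive1nD//; last first.
  by apply: smoothM => //; [exact: smooth_cst|exact: smooth_derive1].
apply: derive1n_ext Iz => y Iy.
rewrite (derive1_mul sphi (sP a) Iy).
by rewrite -[fun x => tau x * psi x]/phi; ring.
Qed.

End OneVariable.

(** A directional derivative of a polynomial is a multiple of its formal derivative, so the
    induction stays among polynomials. *)
Lemma smooth_horner (R : realType) (I : set R) (p : {poly R}) : smooth I (horner p).
Proof.
move=> m; elim: m p => [|m IH] p; first by move=> z _; exact: continuous_horner.
have dp z : differentiable (horner p) z by exact/derivable1_diffP/derivable_horner.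
split=> [z _ //|v].
have -> : 'D_v (horner p) = horner (v *: p^`()).
  apply/funext => z; rewrite hornerZ derivE derive1E' // deriveE//.
  by rewrite -{1}[v]mulr1 -[v * 1]/(v *: (1 : R)) linearZ.
exact: IH.
Qed.

(** The adjoint of the one-term operator [f D^m]. *)
Lemma adj_single (R : realType) (I : set R) (N m : nat) (f psi : R -> R) (z : R) :
  open I -> I z -> (m < N)%N ->
  adj N (fun a y => (a == m)%:R * f y) psi z =
    (-1) ^+ m * derive1n m (fun y => psi y * f y) z.
Proof.
move=> oI Iz mN; rewrite /adj (bigD1 (Ordinal mN))//= big1 ?addr0.
  congr (_ * _); apply: (derive1n_ext oI) Iz => y _.
  by rewrite eqxx mul1r.
move=> a; rewrite -val_eqE /= => /negbTE am.
rewrite -[RHS](mulr0 ((-1) ^+ a)); congr (_ * _).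
rewrite -[RHS](derive1n_0 a z); apply: (derive1n_ext oI) Iz => y _.
by rewrite am mul0r mulr0.
Qed.

(** The adjoint of [M j] times an operator is the adjoint of that operator after multiplication by
    [M j]; evaluation at [1] turns the multipliers into arguments. *)
Lemma adj_sum (R : realType) (I : set R) (J : finType) (N : nat)
    (M : J -> R -> R) (P : J -> nat -> R -> R) (z : R) :
  open I -> (forall j, smooth I (M j)) -> (forall j a, smooth I (P j a)) -> I z ->
  adj N (fun a y => \sum_j M j y * P j a y) (cst 1) z =
    \sum_j adj N (P j) (M j) z.
Proof.
move=> oI sM sP Iz; rewrite /adj exchange_big/=; apply: eq_bigr => a _.
rewrite -mulr_sumr; congr (_ * _).
have sF j : smooth I (fun y => M j y * P j a y) by exact: smoothM.
rewrite -(derive1n_sum oI _ _ sF Iz).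
by apply: (derive1n_ext oI) Iz => y _; rewrite mul1r.
Qed.

(** * Evaluation along a polynomial curve *)

Section UnitVariation.
Variables (R : realType) (n : nat).

(* [unit_vel r a al] vanishes when [r < a], so that the order [a] can range
   over all of [nat]. *)
Definition unit_vel (r a : nat) (al : 'I_n.+1) : vel R n r :=
  \matrix_(b, be) ((b == a :> nat) && (be == al))%:R.

Lemma unit_vel_delta (r : nat) (a : 'I_r.+1) al : delta_mx a al = unit_vel r a al.
Proof. by apply/matrixP => b be; rewrite !mxE. Qed.

Lemma unit_vel0 (r a : nat) al : (r < a)%N -> unit_vel r a al = 0.
Proof.
move=> ra; apply/matrixP => b be; rewrite !mxE; case: eqP => //= ba.
by have := ltn_ord b; rewrite ba ltnS leqNgt ra.
Qed.

Lemma trunc_unit_vel (q r a : nat) al : (r <= q)%N ->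
  trunc r (unit_vel q a al) = unit_vel r a al.
Proof.
move=> rq; apply/matrixP => b be; rewrite !mxE inordK//.
by rewrite (leq_trans (ltn_ord b)).
Qed.

Lemma vel_shift_unit_velS (r a : nat) al :
  vel_shift (unit_vel r.+1 a.+1 al) = unit_vel r a al.
Proof. by apply/matrixP => b be; rewrite !mxE. Qed.

Lemma vel_shift_unit_vel0 (r : nat) al : vel_shift (unit_vel r.+1 0 al) = 0.
Proof. by apply/matrixP => b be; rewrite !mxE. Qed.

Lemma tdot_unit_vel (r a : nat) al : (0 < r)%N ->
  tdot (unit_vel r a al) = ((a == 1%N) && (al == ord0))%:R.
Proof. by move=> r0; rewrite /tdot /uvel mxE inordK// eq_sym [ord0 == _]eq_sym. Qed.

End UnitVariation.

Section Curve.
Variables (R : realType) (n : nat) (X : 'I_n.+1 -> {poly R}).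

Definition vcurve (r : nat) (z : R) : vel R n r :=
  \matrix_(a, al) ((X al)^`(a)).[z].

Lemma trunc_vcurve (q r : nat) (z : R) : (r <= q)%N ->
  trunc r (vcurve q z) = vcurve r z.
Proof.
move=> rq; apply/matrixP => a al; rewrite !mxE inordK//.
by rewrite (leq_trans (ltn_ord a)).
Qed.

Lemma vcurve_deltaE (r : nat) (z : R) : vcurve r z =
  \sum_(p : 'I_r.+1 * 'I_n.+1) (X p.2)^`(p.1).[z] *: delta_mx p.1 p.2.
Proof.
rewrite [LHS]matrix_sum_delta pair_big/=; apply: eq_bigr => p _.
by rewrite mxE.
Qed.

Lemma comp_vcurveE (r : nat) (G : vel R n r -> R) : (fun z => G (vcurve r z)) =
  (fun z => G (\sum_(p : 'I_r.+1 * 'I_n.+1) (X p.2)^`(p.1).[z] *: delta_mx p.1 p.2)).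
Proof. by apply/funext => z; rewrite vcurve_deltaE. Qed.

Lemma smooth_vcurve (I : set R) (r : nat) (O : set (vel R n r)) (G : vel R n r -> R) :
  open I -> (forall z, I z -> O (vcurve r z)) -> smooth O G ->
  smooth I (fun z => G (vcurve r z)).
Proof.
move=> oI IO sG; rewrite comp_vcurveE.
apply: (smooth_comp_frame oI _ sG) => [z Iz|p]; last exact: smooth_horner.
by rewrite -vcurve_deltaE; exact: IO.
Qed.

(** The chain rule: differentiating entry [(a, al)] of the prolonged curve gives its entry
    [(a.+1, al)]. *)
Lemma derive1_vcurve (r : nat) (O : set (vel R n r)) (G : vel R n r -> R) (z : R) :
  smooth O G -> O (vcurve r z) ->
  derive1 (fun z => G (vcurve r z)) z = vtotal G (vcurve r.+1 z).
Proof.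
move=> sG Oz; rewrite derive1E comp_vcurveE.
have dX (p : 'I_r.+1 * 'I_n.+1) : differentiable (horner (X p.2)^`(p.1)) z.
  exact/derivable1_diffP/derivable_horner.
have dG := smooth_differentiable sG Oz.
rewrite vcurve_deltaE in dG.
rewrite (derive_comp_frame (1 : R) dX dG).2 vtotalE; apply: eq_bigr => p _.
by rewrite trunc_vcurve// -vcurve_deltaE mxE -derive1E -derivE -derivnS.
Qed.

(** Total derivatives on velocity spaces thus become iterated derivatives of functions of one
    variable, to which [adj] applies. *)
Lemma vtotaln_vcurve (I : set R) (m r : nat) (O : set (vel R n r))
    (G : vel R n r -> R) (z : R) :
  open I -> open O -> (forall z, I z -> O (vcurve r z)) -> smooth O G -> I z ->
  vtotaln m G (vcurve (m + r) z) = derive1n m (fun z => G (vcurve r z)) z.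
Proof.
move=> oI oO IO sG; elim: m z => [//|m IH] z Iz.
rewrite derive1nS -(derive1_ext oI IH Iz).
rewrite (derive1_vcurve (smooth_vtotaln m oO sG))//=.
by rewrite trunc_vcurve ?leq_addl//; exact: IO.
Qed.

Variable U : set 'rV[R]_n.
Hypothesis oU : open U.

(** The parameters at which the prolonged curve lies in the domain of [wp]; as this set is open,
    identities on it can be differentiated. *)
Definition curve_dom : set R :=
  [set z | U (\row_i (X (lift ord0 i)).[z]) /\ (X ord0)^`().[z] != 0].
Local Notation I := curve_dom.

Lemma open_curve_dom : open I.
Proof.
apply: openI.
  apply: (@open_comp _ _ (fun z : R => \row_i (X (lift ord0 i)).[z]) U) => // z _.
  move: z; apply: matrix_continuous => i j; under eq_fun do rewrite mxE.
  exact: continuous_horner.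
apply: (@open_comp _ _ (horner (X ord0)^`()) [set x | x != 0]).
  by move=> z _; exact: continuous_horner.
exact: open_neq.
Qed.
Let oI := open_curve_dom.

Lemma vel_over_vcurve (r : nat) (z : R) : I z -> vel_over U r (vcurve r z).
Proof.
move=> [Uz _]; rewrite /vel_over /=; rewrite (_ : \row_i _ = \row_i (X (lift ord0 i)).[z])//.
by apply/rowP => i; rewrite !mxE.
Qed.

Definition curve_tdot (z : R) : R := (X ord0)^`().[z].
Definition curve_tau (z : R) : R := (curve_tdot z)^-1.

Lemma curve_tdot_neq0 z : I z -> curve_tdot z != 0. Proof. by case. Qed.

Lemma smooth_curve_tdot : smooth I curve_tdot. Proof. exact: smooth_horner. Qed.

Lemma smooth_curve_tau : smooth I curve_tau.
Proof. exact: (smoothV oI curve_tdot_neq0 smooth_curve_tdot). Qed.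

Lemma tdot_vcurve (r : nat) (z : R) : (0 < r)%N -> tdot (vcurve r z) = curve_tdot z.
Proof. by move=> r0; rewrite /tdot /uvel mxE inordK. Qed.

Lemma vdom_vcurve (r : nat) (z : R) : I z -> vdom U r (vcurve r z).
Proof.
move=> Iz; split; first exact: vel_over_vcurve.
by move=> r0; rewrite tdot_vcurve//; exact: curve_tdot_neq0.
Qed.

Lemma vreg_vcurve (r : nat) (z : R) : I z -> vreg r (vcurve r z).
Proof. by case/(vdom_vcurve r). Qed.

Definition curve_tderiv (a : nat) (i : 'I_n) (z : R) : R := tderiv i (vcurve a z).

Lemma smooth_curve_tderiv a i : smooth I (curve_tderiv a i).
Proof. exact: smooth_vcurve oI (@vreg_vcurve a) (@smooth_tderiv R n a i). Qed.

Lemma curve_tderivS a i z : I z ->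
  curve_tderiv a.+1 i z = curve_tau z * derive1 (curve_tderiv a i) z.
Proof.
move=> Iz; rewrite (derive1_vcurve (@smooth_tderiv R n a i)); last exact: vreg_vcurve.
by rewrite /curve_tderiv /= tdot_vcurve// trunc_vcurve.
Qed.

Lemma smooth_wp_vcurve (r : nat) (F : jet R n r -> R) :
  smooth (jet_over U r) F -> smooth I (fun z => F (wp (vcurve r z))).
Proof. by move=> sF; exact: smooth_vcurve oI (@vdom_vcurve r) (smooth_wp oU sF). Qed.

Lemma derive1_wp_vcurve (r : nat) (F : jet R n r -> R) z :
  smooth (jet_over U r) F -> I z ->
  derive1 (fun z => F (wp (vcurve r z))) z = curve_tdot z * jtotal F (wp (vcurve r.+1 z)).
Proof.
move=> sF Iz; rewrite (derive1_vcurve (smooth_wp oU sF)); last exact: vdom_vcurve.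
rewrite (vtotal_wp oU sF) ?tdot_vcurve//; first exact: vel_over_vcurve.
exact: curve_tdot_neq0.
Qed.

(** The formal adjoint of [tdot^-1 D], which is differentiation by [t] along the curve. *)
Definition neg_dt (psi : R -> R) : R -> R := fun y => - derive1 (fun x => curve_tau x * psi x) y.

Lemma smooth_neg_dt psi : smooth I psi -> smooth I (neg_dt psi).
Proof.
move=> sp; apply: (smoothN oI); apply: smooth_derive1.
exact: (smoothM oI smooth_curve_tau sp).
Qed.

(** On [tdot * g], [curve_tau] cancels [tdot], and the derivative of a function of the jet along the
    curve is [tdot] times its total [t]-derivative; the factor [tdot] reappears, so the step
    iterates. *)
Lemma iter_neg_dt_jtotaln (m r : nat) (F : jet R n r -> R) z :
  smooth (jet_over U r) F -> I z ->
  iter m neg_dt (fun y => curve_tdot y * F (wp (vcurve r y))) z =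
    curve_tdot z * ((-1) ^+ m * jtotaln m F (wp (vcurve (m + r) z))).
Proof.
move=> sF; elim: m z => [|m IH] z Iz; first by rewrite mul1r.
have sJ := smooth_jtotaln oU m sF.
rewrite iterS {1}/neg_dt (derive1_ext oI (g := fun y => (-1) ^+ m *
    jtotaln m F (wp (vcurve (m + r) y))) _ Iz); last first.
  by move=> y Iy; rewrite IH// /curve_tau mulKf// curve_tdot_neq0.
rewrite (derive1_scal _ (smooth_wp_vcurve sJ) Iz) (derive1_wp_vcurve sJ Iz).
rewrite -[jtotaln m.+1 F _]/(jtotal (jtotaln m F) (wp (vcurve (m + r).+1 z))) exprS.
by ring.
Qed.

(** The coefficient [d v_b / d x^al_(a)] of [D^a] in [l_b], evaluated along the curve. *)
Definition tderiv_var (al : 'I_n.+1) (i : 'I_n) (b a : nat) (z : R) : R :=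
  'D_(unit_vel R b a al) (@tderiv R n b i) (vcurve b z).

Lemma smooth_tderiv_var al i b a : smooth I (tderiv_var al i b a).
Proof.
exact: smooth_vcurve oI (@vreg_vcurve b) (smoothDv _ (@smooth_tderiv R n b i)).
Qed.

Lemma tderiv_var_eq0 al i b a z : (b < a)%N -> tderiv_var al i b a z = 0.
Proof. by move=> ba; rewrite /tderiv_var unit_vel0// derive0. Qed.

Lemma tderiv_var0 al i a z : tderiv_var al i 0 a z = (a == 0%N)%:R * (lift ord0 i == al)%:R.
Proof.
by rewrite /tderiv_var [LHS]derive_coord mxE -natrM mulnb eq_sym.
Qed.

(** The recursion for [l_(b+1)] read coefficientwise: [D o l_b] contributes a differentiated
    coefficient and a shifted one, absent at order [0]; varying the factor [tdot^-1] contributes the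
    last term. *)
Lemma tderiv_varS al i b a z : I z -> tderiv_var al i b.+1 a z =
  curve_tau z * (derive1 (tderiv_var al i b a) z +
    (if a is a'.+1 then tderiv_var al i b a' z else 0))
  + (a == 1%N)%:R * (- ((al == ord0)%:R * (curve_tau z * curve_tderiv b.+1 i z))).
Proof.
move=> Iz; rewrite {1}/tderiv_var (derive_tderivS _ _); last first.
  by rewrite tdot_vcurve// curve_tdot_neq0.
rewrite trunc_vcurve// trunc_unit_vel// tdot_vcurve// tdot_unit_vel//.
have -> : derive1 (tderiv_var al i b a) z =
    vtotal ('D_(unit_vel R b a al) (@tderiv R n b i)) (vcurve b.+1 z).
  rewrite (derive1_vcurve (smoothDv _ (@smooth_tderiv R n b i)))//.
  exact: vreg_vcurve.
have -> : 'D_(vel_shift (unit_vel R b.+1 a al)) (@tderiv R n b i) (vcurve b z) =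
    if a is a'.+1 then tderiv_var al i b a' z else 0.
  case: a => [|a]; first by rewrite vel_shift_unit_vel0 derive0.
  by rewrite vel_shift_unit_velS.
rewrite -mulnb natrM -/(curve_tderiv b.+1 i z) -/(curve_tau z) [X in curve_tau z * X]addrC.
by congr (_ + _); ring.
Qed.

(** Component [al] of the contact form [dx^i - v^i dt]. *)
Definition kappa (al : 'I_n.+1) (i : 'I_n) (z : R) : R :=
  (lift ord0 i == al)%:R - (al == ord0)%:R * curve_tderiv 1 i z.

(** Induction on [b], with [psi] generalised because each step replaces it by [neg_dt psi]; [b <= k]
    makes all orders of [l_b] fit into [k.+1] terms. *)
Lemma adj_tderiv_var al i k b psi z : (0 < k)%N -> (b <= k)%N -> smooth I psi -> I z ->
  adj k.+1 (tderiv_var al i b) psi z =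
    kappa al i z * iter b neg_dt psi z + (al == ord0)%:R * (curve_tderiv b.+1 i z * psi z).
Proof.
move=> k0; elim: b psi => [|b IH] psi bk sp Iz.
  rewrite (adj_ext oI (Q := fun a y =>
    (a == 0%N)%:R * (lift ord0 i == al)%:R) (psi := psi) _ _ Iz).
    (* At [b = 0] the two terms in [v_1] cancel and the Kronecker delta remains. *)
    rewrite (adj_single (fun=> (lift ord0 i == al)%:R) _ oI Iz)// /kappa/= mul1r.
    by ring.
  by move=> a y _; rewrite tderiv_var0.
pose step a y := curve_tau y * (derive1 (tderiv_var al i b a) y +
  (if a is a'.+1 then tderiv_var al i b a' y else 0)).
pose f y := - ((al == ord0)%:R * (curve_tau y * curve_tderiv b.+1 i y)).
have stau := smooth_curve_tau; have sV := smooth_curve_tderiv b.+1 i.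
have sal : smooth I (cst (al == ord0)%:R : R -> R) by exact: smooth_cst.
have sf : smooth I f by apply: smoothN => //; apply: smoothM => //; exact: smoothM.
have sstep a : smooth I (step a).
  apply: smoothM => //; apply: smoothD => //; first exact/smooth_derive1/smooth_tderiv_var.
  by case: a => [|a]; [exact: smooth_cst|exact: smooth_tderiv_var].
have sc (a : nat) : smooth I (fun y => (a == 1%N)%:R * f y).
  by apply: smoothM => //; exact: smooth_cst.
rewrite (adj_ext oI (Q := fun a y => step a y + (a == 1%N)%:R * f y)
  (psi := psi) _ _ Iz); last first.
  by move=> a y Iy; rewrite tderiv_varS.
rewrite (adjD oI _ sstep sc sp Iz) (adj_single f psi oI Iz)//.
(* Here [N = k]: the truncation is exact because [b < k], so [l_b] has no term of order [k]. *)
rewrite (adj_step (P := tderiv_var al i b) (tau := curve_tau) oI _ _ sp _ _ _ Iz) => //; first last.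
- by move=> y _; rewrite tderiv_var_eq0.
- by move=> y Iy; rewrite /step addr0.
- by move=> a; exact: smooth_tderiv_var.
rewrite -/(neg_dt psi) (IH _ (ltnW bk) (smooth_neg_dt sp) Iz) -iterSr.
have -> : derive1n 1 (fun y => psi y * f y) z =
    - (al == ord0)%:R * derive1 (fun y => (curve_tau y * psi y) * curve_tderiv b.+1 i y) z.
  have stv : smooth I (fun y => curve_tau y * psi y * curve_tderiv b.+1 i y).
    by apply: smoothM => //; exact: smoothM.
  rewrite -(derive1_scal _ stv Iz) /derive1n/=.
  by apply: (derive1_ext oI) Iz => y _; rewrite /f; ring.
(* The part with the derivative of [tau * psi] cancels the [v_(b+1)] term of the induction
   hypothesis at [neg_dt psi]; in the other part, [tau] times the derivative of [v_(b+1)] is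
   [v_(b+2)]. *)
rewrite (derive1_mul (smoothM oI stau sp) sV Iz).
rewrite [curve_tderiv b.+2 i z]curve_tderivS// /neg_dt; ring.
Qed.

End Curve.

(** * Euler-Lagrange expressions of the homogeneous Lagrangian along a curve *)

Lemma smooth_homLagrangian (R : realType) (n k : nat) (U : set 'rV[R]_n)
    (L : jet R n k -> R) :
  open U -> smooth (jet_over U k) L -> smooth (vdom U k) (homLagrangian L).
Proof.
move=> oU sL; have st : smooth (vdom U k) (@tdot R n k) by exact: smooth_coord.
exact: (smoothM (@open_vdom R n U oU k) st (smooth_wp oU sL)).
Qed.

Lemma derive_homLagrangian (R : realType) (n k : nat) (U : set 'rV[R]_n)
    (L : jet R n k -> R) (w h : vel R n k) :
  open U -> smooth (jet_over U k) L -> vdom U k w ->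
  'D_h (homLagrangian L) w =
    tdot h * L (wp w) + tdot w * 'D_h (fun w => L (wp w)) w.
Proof.
move=> oU sL Ow.
have st : smooth (vdom U k) (@tdot R n k) by exact: smooth_coord.
have dt : derivable (@tdot R n k) w h := smooth_derivable st Ow.
have dL : derivable (fun w => L (wp w)) w h := smooth_derivable (smooth_wp oU sL) Ow.
have -> : 'D_h (homLagrangian L) w = tdot w *: 'D_h (fun w => L (wp w)) w +
    L (wp w) *: 'D_h (@tdot R n k) w by exact: deriveM dt dL.
have -> : 'D_h (@tdot R n k) w = tdot h by exact: derive_coord.
by rewrite /GRing.scale/= addrC [L _ * _]mulrC.
Qed.

Section CurveEulerLagrange.
Variables (R : realType) (n k : nat) (U : set 'rV[R]_n) (L : jet R n k -> R).
Hypotheses (k0 : (0 < k)%N) (oU : open U) (sL : smooth (jet_over U k) L).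
Variable X : 'I_n.+1 -> {poly R}.
Local Notation I := (curve_dom X U).
Local Notation c := (vcurve X).
Let oI : open I := @open_curve_dom R n X U oU.

(** The homogeneous Lagrangian depends on the velocity through the factor [tdot], through [t] and
    through the jet coordinates [v_b]; each gives one summand. *)
Lemma vpartial_homLagrangian (al : 'I_n.+1) (a : nat) z : I z ->
  'D_(unit_vel R k a al) (homLagrangian L) (c k z) =
    (a == 1%N)%:R * ((al == ord0)%:R * L (wp (c k z))) +
    ((a == 0%N)%:R * ((al == ord0)%:R * (curve_tdot X z * jpartial_t L (wp (c k z)))) +
    \sum_(p : 'I_k.+1 * 'I_n)
      (curve_tdot X z * jpartial p.1 p.2 L (wp (c k z))) * tderiv_var X al p.2 p.1 a z).
Proof.
move=> Iz; have Oz := vdom_vcurve k Iz.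
rewrite (derive_homLagrangian _ oU sL Oz) (derive_wp oU _ sL Oz).
rewrite tdot_unit_vel// tdot_vcurve// mxE -!mulnb !natrM.
rewrite pair_big/= mulrDr mulr_sumr; congr (_ + (_ + _)); first by ring.
  by rewrite eq_sym [ord0 == al]eq_sym; ring.
apply: eq_bigr => -[b i] _ /=; have bk : (b <= k)%N by exact: ltn_ord b.
by rewrite trunc_unit_vel// trunc_vcurve// /tderiv_var; ring.
Qed.

(** Arranged so that its terms match the summands [v_(b+1) psi] of the adjoints, against which they
    cancel when [al = ord0]. *)
Lemma derive1_L_vcurve z : I z ->
  derive1 (fun z => L (wp (c k z))) z = curve_tdot X z * jpartial_t L (wp (c k z)) +
    \sum_(p : 'I_k.+1 * 'I_n)
      curve_tderiv X p.1.+1 p.2 z * (curve_tdot X z * jpartial p.1 p.2 L (wp (c k z))).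
Proof.
move=> Iz; rewrite (derive1_wp_vcurve oU sL Iz) /jtotal jtrunc_wp// trunc_vcurve//.
rewrite mulrDr pair_big/= mulr_sumr; congr (_ + _); apply: eq_bigr => -[b i] _ /=.
rewrite mxE trunc_vcurve; last exact: ltn_ord (lift ord0 b).
by rewrite -[tderiv i _]/(curve_tderiv X b.+1 i z); ring.
Qed.

Lemma jEL_vcurve (i : 'I_n) z : I z ->
  \sum_(a < k.+1) iter a (neg_dt X)
    (fun y => curve_tdot X y * jpartial a i L (wp (c k y))) z =
  curve_tdot X z * jEL L i (wp (c (2 * k) z)).
Proof.
move=> Iz; rewrite /jEL mulr_sumr; apply: eq_bigr => a _.
have ak : (a + k <= 2 * k)%N by rewrite mul2n -addnn leq_add2r -ltnS.
by rewrite (iter_neg_dt_jtotaln oU _ (smoothDv _ sL) Iz) jtrunc_wp// trunc_vcurve.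
Qed.

(** Both formulas of the theorem at once: the expressions on jets are contracted with the contact
    components [kappa]. *)
Lemma vEL_vcurve (al : 'I_n.+1) z : I z ->
  vEL (homLagrangian L) al (c (2 * k) z) =
  \sum_i kappa X al i z * (curve_tdot X z * jEL L i (wp (c (2 * k) z))).
Proof.
move=> Iz; have sH := smooth_homLagrangian oU sL.
pose l y := L (wp (c k y)); pose lt y := curve_tdot X y * jpartial_t L (wp (c k y)).
pose M (p : 'I_k.+1 * 'I_n) y := curve_tdot X y * jpartial p.1 p.2 L (wp (c k y)).
pose A : R := (al == ord0)%:R.
have sT : smooth I (curve_tdot X) by exact: smooth_curve_tdot.
have sl : smooth I l by exact: smooth_wp_vcurve.
have slt : smooth I lt.
  by apply: smoothM => //; exact: (smooth_wp_vcurve _ oU (smoothDv _ sL)).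
have sM p : smooth I (M p).
  by apply: smoothM => //; exact: (smooth_wp_vcurve _ oU (smoothDv _ sL)).
have sP (p : 'I_k.+1 * 'I_n) a : smooth I (tderiv_var X al p.2 p.1 a) by exact: smooth_tderiv_var.
have sc (x : R) : smooth I (cst x : R -> R) by exact: smooth_cst.
(* The linearised Lagrangian is split by origin: [Q1] from the factor [tdot], [Q0] from [t], [Q]
   from the jet coordinates. *)
pose Q1 (a : nat) y := (a == 1%N)%:R * (A * l y).
pose Q0 (a : nat) y := (a == 0%N)%:R * (A * lt y).
pose Q a y := \sum_p M p y * tderiv_var X al p.2 p.1 a y.
have sAl : smooth I (fun y => A * l y) := smoothM oI (sc A) sl.
have sAlt : smooth I (fun y => A * lt y) := smoothM oI (sc A) slt.
have sQ1 a : smooth I (Q1 a) := smoothM oI (sc _) sAl.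
have sQ0 a : smooth I (Q0 a) := smoothM oI (sc _) sAlt.
have sQ a : smooth I (Q a).
  by apply: (smooth_sum _ oI) => p; exact: (smoothM oI (sM p) (sP p a)).
have sQ' a : smooth I (fun y => Q0 a y + Q a y) := smoothD oI (sQ0 a) (sQ a).
have -> : vEL (homLagrangian L) al (c (2 * k) z) =
    adj k.+1 (fun a y => Q1 a y + (Q0 a y + Q a y)) (cst 1) z.
  apply: eq_bigr => a _; congr (_ * _).
  have ak : (a + k <= 2 * k)%N by rewrite mul2n -addnn leq_add2r -ltnS.
  rewrite trunc_vcurve//.
  rewrite (vtotaln_vcurve a oI (@open_vdom R n U oU k) (@vdom_vcurve _ _ X U k) (smoothDv _ sH) Iz).
  apply: (derive1n_ext oI) Iz => y Iy; rewrite mul1r.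
  by rewrite unit_vel_delta vpartial_homLagrangian.
rewrite (adjD oI _ sQ1 sQ' (sc 1) Iz) (adjD oI _ sQ0 sQ (sc 1) Iz).
rewrite (adj_single (fun y => A * l y) _ oI Iz)// (adj_single (fun y => A * lt y) _ oI Iz)//.
rewrite (adj_sum _ oI sM sP Iz).
have -> : derive1n 1 (fun y => cst 1 y * (A * l y)) z = A * derive1 l z.
  rewrite -(derive1_scal _ sl Iz); apply: (derive1_ext oI) Iz => y _.
  by rewrite mul1r.
rewrite derive1_L_vcurve//.
have adjPE (p : 'I_k.+1 * 'I_n) : adj k.+1 (tderiv_var X al p.2 p.1) (M p) z =
    kappa X al p.2 z * iter p.1 (neg_dt X) (M p) z +
    A * (curve_tderiv X p.1.+1 p.2 z * M p z).
  by rewrite (adj_tderiv_var oU al p.2 k0 _ (sM p) Iz)// -ltnS.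
rewrite (eq_bigr _ (fun p _ => adjPE p)) big_split/= -mulr_sumr.
rewrite -/(lt z) expr1 expr0 mulN1r !mul1r mulrDr opprD.
rewrite (_ : \sum_i kappa X al i z * _ =
    \sum_(p : 'I_k.+1 * 'I_n) kappa X al p.2 z * iter p.1 (neg_dt X) (M p) z).
  (* The terms with factor [A] sum to zero: minus the derivative of [l] cancels [lt] and the sum of
     the [v_(b+1) M]. *)
  rewrite [X in _ - A * X](_ : _ =
    \sum_(p : 'I_k.+1 * 'I_n) curve_tderiv X p.1.+1 p.2 z * M p z)//.
  by ring.
under eq_bigr do rewrite -jEL_vcurve// mulr_sumr.
by rewrite exchange_big pair_big.
Qed.

End CurveEulerLagrange.

(** A Taylor polynomial at [0]: the division by [a!] compensates the factor produced by [a]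
    derivatives. *)
Lemma ex_vcurve (R : realType) (n r : nat) (w : vel R n r) :
  exists X : 'I_n.+1 -> {poly R}, vcurve X r 0 = w.
Proof.
exists (fun al => \poly_(a < r.+1) (w (inord a) al / a`!%:R)).
apply/matrixP => a al; rewrite mxE horner_coef0 coef_derivn addn0 coef_poly.
by rewrite ltn_ord inord_val ffactnn -[_ *+ _]mulr_natr divfK//.
Qed.

Lemma derive1_curve_tderiv0 (R : realType) (n : nat) (X : 'I_n.+1 -> {poly R}) (i : 'I_n) z :
  derive1 (curve_tderiv X 0 i) z = (X (lift ord0 i))^`().[z].
Proof.
rewrite (_ : curve_tderiv X 0 i = horner (X (lift ord0 i))) -?derivE//.
by apply/funext => y; rewrite /curve_tderiv /= mxE.
Qed.

(** The family [E] encodes the descent to order [s]: the expressions [jEL], formed at order [2 * k],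
    are pulled back from functions of the [s]-jet over the chart [U]. *)
Theorem proposition1 (R : realType) (n k s : nat) (U : set 'rV[R]_n)
    (L : jet R n k -> R) (E : 'I_n -> jet R n s -> R) :
  (0 < k)%N ->
  open U ->
  smooth (jet_over U k) L ->
  (s <= 2 * k)%N ->
  (forall (i : 'I_n) (j : jet R n (2 * k)), jet_over U (2 * k) j ->
     jEL L i j = E i (jtrunc s j)) ->
  forall w : vel R n (2 * k), vel_over U (2 * k) w -> tdot w != 0 ->
    vEL (homLagrangian L) ord0 w =
      - \sum_(i < n) uvel w (lift ord0 i) * E i (wp (trunc s w)) /\
    (forall i : 'I_n,
       vEL (homLagrangian L) (lift ord0 i) w = tdot w * E i (wp (trunc s w))).
Proof.
move=> k0 oU sL sk EL w Uw w0.
have EwE i : E i (wp (trunc s w)) = jEL L i (wp w).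
  by rewrite EL ?jtrunc_wp// jet_over_wp.
have [X Xw] := ex_vcurve w.
have k20 : (0 < 2 * k)%N by rewrite muln_gt0.
have Tw : curve_tdot X 0 = tdot w by rewrite -Xw tdot_vcurve.
have Iz : curve_dom X U 0.
  split; last by rewrite -[X in X != 0]/(curve_tdot X 0) Tw.
  move: Uw; rewrite -Xw /vel_over /=; congr U.
  by apply/rowP => i; rewrite !mxE.
have H al := vEL_vcurve k0 oU sL al Iz.
split=> [|i]; rewrite -{1}Xw H Xw Tw.
  (* For the coordinate [t], [kappa] is [- v_1], and [tdot * v_1] is [u^i]. *)
  rewrite -sumrN; apply: eq_bigr => i _; rewrite EwE /kappa eqxx.
  rewrite eq_sym (negbTE (neq_lift _ _)) sub0r mul1r mulNr mulrA; congr (- (_ * _)).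
  rewrite (curve_tderivS _ _ Iz) /curve_tau Tw derive1_curve_tderiv0.
  rewrite mulrAC mulVf// mul1r -Xw.
  by rewrite /uvel !mxE inordK.
(* For the coordinate [x^i], [kappa] is a Kronecker delta, so one summand survives. *)
rewrite (bigD1 i)//= big1 ?addr0 => [|j ji].
  by rewrite /kappa eqxx eq_sym (negbTE (neq_lift _ _)) mul0r subr0 mul1r EwE.
rewrite /kappa (inj_eq (@lift_inj _ _)) (negbTE ji).
by rewrite eq_sym (negbTE (neq_lift _ _)) mul0r subr0 mul0r.
Qed.
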